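(* Suppose that $c$ with $0<c<1/2$ is given. If $T$ is sufficiently large and $$M\ge \exp\left(e\sqrt{\tfrac12\,\log T\,\log\log T\,\log\log\log T}\right),$$ then $$\max_{t\in[\sqrt T,T]}|D_M(t)|\ge \exp\left(c\sqrt{\frac{\log T\,\log\log\log T}{\log\log T}}\right).$$
   Context: For $M\ge 1$ and real $t$, $D_M(t)=\sum_{n\le M} n^{-1/2-it}$, the sum being over positive integers $n\le M$. ''$T$ sufficiently large'' means $T\ge T_0$ with $T_0$ depending only on $c$. *)

(* Defs.v *)
From Stdlib Require Import Reals ZArith.
From Coquelicot Require Import Coquelicot.
Open Scope R_scope.

Definition Cexp (z : C) : C :=
  (exp (Re z) * cos (Im z), exp (Re z) * sin (Im z)).

(* Principal power [n ^ s]; meaningful for [1 <= n] only. *)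
Definition nat_Cpower (n : nat) (s : C) : C := Cexp (s * RtoC (ln (INR n)))%C.

(* [Int_part] is the floor, so for [1 <= M] the range is all positive
   integers [n <= M]. *)
Definition zeta_sum (M t : R) : C :=
  sum_n_m (fun n : nat => nat_Cpower n (RtoC (- (1 / 2)) - Ci * RtoC t)%C)
          1 (Z.to_nat (Int_part M)).

Definition is_max_on (f : R -> R) (a b m : R) : Prop :=
  (exists t : R, a <= t <= b /\ f t = m) /\
  (forall t : R, a <= t <= b -> f t <= m).

(* Main.v *)
Require Import Defs.
From Stdlib Require Import Reals Lra Lia ZArith.
From Coquelicot Require Import Coquelicot.
From HB Require Import structures.
From mathcomp Require Import all_boot zify.
Set Implicit Arguments.
Unset Strict Implicit.
Unset Printing Implicit Defensive.
Open Scope R_scope.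

(** Write D(t) for the sum of n^(-1/2-it) over n <= M, and x, y, z for log T,
    log log T, log log log T.

    The lower bound is a resonance argument.  Fix two trigonometric polynomials
    R1, R2 with nonnegative coefficients, put L = floor T, and average
    Re (D R1 conj(R2)) over the points t = a - b with 0 <= a, b < L.  Each
    frequency w of the expanded product contributes the sum of cos((a-b) w) over
    a and b, which is the squared modulus of the sum of e^(iaw) over a < L: every
    term is nonnegative, so the average is bounded below by any subfamily of its
    terms, and integers n <= M that are not wanted can be dropped.  The average is
    also at most the largest |D(t)| with sqrt T <= t <= T times the mean squares of
    R1 and R2, plus the contribution of |t| < sqrt T.  Averaging over differences of
    integers makes everything a finite sum and confines t to [-T, T].

    The natural frequencies of R1 and R2 are logarithms of integers m much larger
    than T, hence badly spaced.  They are rounded to multiples of 2 pi / (6L), and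
    the coefficients f(m) of the integers falling in one bucket are replaced by
    their quadratic mean.  On the rounded frequencies the mean square is computed
    exactly by orthogonality of characters modulo 6L, while the Cauchy-Schwarz
    inequality keeps all products f(m) g(nm) on the other side ([resonance]).

    The integers m are products of primes from the blocks (A^k Y, A^(k+1) Y],
    where Y is about x y and k runs from 3 to about y^(1-d): R2 uses the products
    of J_k primes from each block, R1 those of J_k - i_k primes, with weights
    m^(-1/2), and n runs over the products of i_k primes from each block.  The
    gain is then a product over blocks of binomial(J,i) sqrt(E_J / E_(J-i)), with
    E_j the elementary symmetric sums of the 1/p ([gal_resonance]).  Since
    (j+1) E_(j+1) is nearly E_j times the sum s of the 1/p, each factor is about
    (J s)^(i/2) / i!, which is nearly e^i when i = sqrt(J s).  Mertens' theorem
    gives s close to log A / y ([mertens_window]); with J_k = x / (4 k^2 z log A)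
    the sum of the i_k is close to (1/2) sqrt(x z / y), and the number of
    products used is at most T^(1/4 - d/8) ([resonance_bound]).

    That size is what the range |t| < sqrt T allows: there
    |D(t)| = O(sqrt t + sqrt M / t) by first order Euler-Maclaurin summation
    ([dnorm_upper]), hence the sum of |D(t)| is O(T^(3/4) log T) as long as
    M = O(T^(3/2)).  For longer sums the same formula shows that D(sqrt T) is
    dominated by its main term and is at least T^(1/4) ([long_sum_large]). *)


(** * Finite sums and products of real numbers *)

HB.instance Definition _ := Monoid.isComLaw.Build R 0 Rplus
  (fun x y z => esym (Rplus_assoc x y z)) Rplus_comm Rplus_0_l.
HB.instance Definition _ := Monoid.isComLaw.Build R 1 Rmult
  (fun x y z => esym (Rmult_assoc x y z)) Rmult_comm Rmult_1_l.
HB.instance Definition _ := Monoid.isMulLaw.Build R 0 Rmult Rmult_0_l Rmult_0_r.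
HB.instance Definition _ := Monoid.isAddLaw.Build R Rmult Rplus
  Rmult_plus_distr_r Rmult_plus_distr_l.

Notation "\sum_ ( i <- r ) F" := (\big[Rplus/0]_(i <- r) F) : R_scope.
Notation "\sum_ ( i | P ) F" := (\big[Rplus/0]_(i | P%B) F) : R_scope.
Notation "\sum_ i F" := (\big[Rplus/0]_i F) : R_scope.
Notation "\sum_ ( i : t | P ) F" := (\big[Rplus/0]_(i : t | P%B) F) : R_scope.
Notation "\sum_ ( i : t ) F" := (\big[Rplus/0]_(i : t) F) : R_scope.
Notation "\sum_ ( i < n | P ) F" := (\big[Rplus/0]_(i < n | P%B) F) : R_scope.
Notation "\sum_ ( i < n ) F" := (\big[Rplus/0]_(i < n) F) : R_scope.
Notation "\sum_ ( i 'in' A | P ) F" := (\big[Rplus/0]_(i in A | P%B) F) : R_scope.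
Notation "\sum_ ( i 'in' A ) F" := (\big[Rplus/0]_(i in A) F) : R_scope.
Notation "\prod_ ( i | P ) F" := (\big[Rmult/1]_(i | P%B) F) : R_scope.
Notation "\prod_ i F" := (\big[Rmult/1]_i F) : R_scope.
Notation "\prod_ ( i < n ) F" := (\big[Rmult/1]_(i < n) F) : R_scope.
Notation "\prod_ ( i 'in' A ) F" := (\big[Rmult/1]_(i in A) F) : R_scope.

Lemma sqr_le_le a b : 0 <= b -> a ^ 2 <= b ^ 2 -> a <= b.
Proof. by rewrite -!Rsqr_pow2 => b0 h; apply: Rsqr_incr_0_var. Qed.

Lemma sum_sqr_ge0 a b : 0 <= a ^ 2 + b ^ 2.
Proof. by have := pow2_ge_0 a; have := pow2_ge_0 b; lra. Qed.

Section BigR.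
Variable I : finType.
Implicit Types (P : pred I) (F G : I -> R).

Lemma sumR_le P F G : (forall i, P i -> F i <= G i) ->
  \sum_(i | P i) F i <= \sum_(i | P i) G i.
Proof. move=> h; apply: (big_ind2 Rle)=> //; [lra|move=> *; lra]. Qed.

Lemma sumR_ge0 P F : (forall i, P i -> 0 <= F i) -> 0 <= \sum_(i | P i) F i.
Proof. move=> h; apply: (big_ind (Rle 0))=> //; [lra|move=> *; lra]. Qed.

Lemma sumR_le_cond P (Q : pred I) F : (forall i, P i -> Q i) -> (forall i, Q i -> 0 <= F i) ->
  \sum_(i | P i) F i <= \sum_(i | Q i) F i.
Proof.
move=> PQ F0; rewrite big_mkcond [X in _ <= X]big_mkcond; apply: sumR_le => i _.
by case: ifP => [/PQ ->|_]; [lra|case: ifP => [/F0|_] //; lra].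
Qed.

Lemma sumR_distrr a P F : a * \sum_(i | P i) F i = \sum_(i | P i) a * F i.
Proof. exact: (@big_distrr R 0 Rmult Rplus). Qed.

Lemma sumR_distrl a P F : (\sum_(i | P i) F i) * a = \sum_(i | P i) F i * a.
Proof. exact: (@big_distrl R 0 Rmult Rplus). Qed.

Lemma sumR_const P c : \sum_(i | P i) c = INR #|P| * c.
Proof.
rewrite big_const; elim: #|_| => [|n IH]; first by rewrite /=; lra.
by rewrite iterS IH S_INR; lra.
Qed.

Lemma sumR_add P F G :
  \sum_(i | P i) (F i + G i) = \sum_(i | P i) F i + \sum_(i | P i) G i.
Proof. exact: big_split. Qed.

Lemma sumR_opp P F : \sum_(i | P i) - F i = - \sum_(i | P i) F i.
Proof.
rewrite (_ : - (\sum_(i | P i) F i) = (-1) * (\sum_(i | P i) F i)); last by lra.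
by rewrite sumR_distrr; apply: eq_bigr => i _; lra.
Qed.

Lemma sumR_sub P F G :
  \sum_(i | P i) (F i - G i) = \sum_(i | P i) F i - \sum_(i | P i) G i.
Proof. by rewrite /Rminus -sumR_opp -big_split. Qed.

Lemma sumR_ge_term P F j : P j -> (forall i, P i -> 0 <= F i) ->
  F j <= \sum_(i | P i) F i.
Proof.
move=> Pj h; rewrite (bigD1 j) //=.
have := @sumR_ge0 (fun i => P i && (i != j)) F (fun i hi => h i (proj1 (andP hi))).
by lra.
Qed.

Lemma prodR_ge0 P F : (forall i, P i -> 0 <= F i) -> 0 <= \prod_(i | P i) F i.
Proof. move=> h; apply: (big_ind (Rle 0))=> //; [lra|exact: Rmult_le_pos]. Qed.

Lemma prodR_gt0 P F : (forall i, P i -> 0 < F i) -> 0 < \prod_(i | P i) F i.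
Proof. move=> h; apply: (big_ind (Rlt 0))=> //; [lra|exact: Rmult_lt_0_compat]. Qed.

Lemma prodR_le P F G : (forall i, P i -> 0 <= F i <= G i) ->
  \prod_(i | P i) F i <= \prod_(i | P i) G i.
Proof.
move=> h.
have: 0 <= \prod_(i | P i) F i <= \prod_(i | P i) G i; last by case.
apply: (big_ind2 (fun a b => 0 <= a <= b)) => //; first by lra.
by move=> a b c d [? ?] [? ?]; split; [apply: Rmult_le_pos|apply: Rmult_le_compat].
Qed.

Lemma sqr_sum F : (\sum_i F i) * (\sum_i F i) = \sum_i \sum_j F i * F j.
Proof. by rewrite sumR_distrl; apply: eq_bigr => i _; rewrite sumR_distrr. Qed.

(** The quadratic form |x F + y G|^2 is nonnegative for all x and y; it is
    evaluated at (-b, a), where a and b are its first two coefficients. *)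
Lemma cauchy_schwarz P F G :
  (\sum_(i | P i) F i * G i) ^ 2 <=
  (\sum_(i | P i) F i ^ 2) * (\sum_(i | P i) G i ^ 2).
Proof.
set a := \sum_(i | P i) F i ^ 2; set b := \sum_(i | P i) F i * G i.
set c := \sum_(i | P i) G i ^ 2.
have a0 : 0 <= a by apply: sumR_ge0 => i _; exact: pow2_ge_0.
have c0 : 0 <= c by apply: sumR_ge0 => i _; exact: pow2_ge_0.
have key x y : 0 <= x ^ 2 * a + 2 * (x * y) * b + y ^ 2 * c.
  rewrite /a /b /c !sumR_distrr -!big_split /=.
  apply: sumR_ge0 => i _; have := pow2_ge_0 (x * F i + y * G i); nra.
case: (Req_dec a 0) => [a_0|an0].
  case: (Req_dec b 0) => [->|bn0]; first by nra.
  (* with a = 0 the form is affine in x, and this x makes it equal to -1 *)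
  have := key (- (c + 1) / (2 * b)) 1; rewrite a_0.
  have -> : 2 * (- (c + 1) / (2 * b) * 1) * b = - (c + 1) by field.
  by lra.
have ap : 0 < a by lra.
have := key (- b) a => h; apply: (Rmult_le_reg_l a) => //; nra.
Qed.

Lemma cauchy_schwarz_sqrt P F G : 
  \sum_(i | P i) F i * G i <=
  sqrt (\sum_(i | P i) F i ^ 2) * sqrt (\sum_(i | P i) G i ^ 2).
Proof.
have := cauchy_schwarz P F G; set x := \sum_(i | P i) F i * G i => h.
rewrite -sqrt_mult_alt; last by apply: sumR_ge0 => i _; exact: pow2_ge_0.
apply: (Rle_trans _ _ _ (Rle_abs x)); rewrite -sqrt_Rsqr_abs; apply: sqrt_le_1_alt.
by rewrite Rsqr_pow2.
Qed.
End BigR.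

Lemma exchange_sum3 (A B S : finType) (F : A -> B -> S -> R) :
  \sum_a \sum_b \sum_s F a b s = \sum_s \sum_a \sum_b F a b s.
Proof.
transitivity (\sum_a \sum_s \sum_b F a b s).
  by apply: eq_bigr => a _; rewrite exchange_big.
by rewrite exchange_big.
Qed.

Lemma sumR_recr n (F : nat -> R) : \sum_(i < n.+1) F i = \sum_(i < n) F i + F n.
Proof. exact: big_ord_recr. Qed.

(** * Trigonometric sums and the Fejer kernel *)

Definition csum (I : finType) (w phi : I -> R) := \sum_i w i * cos (phi i).
Definition ssum (I : finType) (w phi : I -> R) := \sum_i w i * sin (phi i).
(** The modulus of the exponential sum of the w_i e^(i phi_i). *)
Definition tnorm (I : finType) (w phi : I -> R) :=
  sqrt (csum w phi ^ 2 + ssum w phi ^ 2).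

Lemma tnorm_ge0 (I : finType) (w phi : I -> R) : 0 <= tnorm w phi.
Proof. exact: sqrt_pos. Qed.

Lemma tnorm_sqr (I : finType) (w phi : I -> R) :
  tnorm w phi ^ 2 = \sum_i \sum_j w i * w j * cos (phi i - phi j).
Proof.
rewrite pow2_sqrt; last exact: sum_sqr_ge0.
rewrite /csum /ssum /= !Rmult_1_r !sqr_sum -big_split; apply: eq_bigr => i _ /=.
by rewrite -big_split; apply: eq_bigr => j _ /=; rewrite cos_minus; ring.
Qed.

Lemma tnorm_le_sum (I : finType) (w phi : I -> R) : (forall i, 0 <= w i) ->
  tnorm w phi <= \sum_i w i.
Proof.
move=> w0; have S0 : 0 <= \sum_i w i by apply: sumR_ge0.
apply: sqr_le_le => //.
rewrite tnorm_sqr /= Rmult_1_r sqr_sum; apply: sumR_le => i _; apply: sumR_le => j _.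
have := Rmult_le_pos _ _ (w0 i) (w0 j); case: (COS_bound (phi i - phi j)) => _ h ww.
by rewrite -[X in _ <= X]Rmult_1_r; apply: Rmult_le_compat_l.
Qed.

Lemma tnormN (I : finType) (w phi : I -> R) : tnorm w (fun i => - phi i) = tnorm w phi.
Proof.
rewrite /tnorm; congr sqrt; congr (_ + _).
  by congr (_ ^ _); apply: eq_bigr => i _; rewrite cos_neg.
have -> : ssum w (fun i => - phi i) = - ssum w phi; last by ring.
by rewrite /ssum -sumR_opp; apply: eq_bigr => i _; rewrite sin_neg; ring.
Qed.

(** The left side is the real part of a product of three exponential sums, the
    third one conjugated. *)
Lemma trig_sum3_le (I J K : finType) (u al : I -> R) (v be : J -> R) (w ga : K -> R) :
  \sum_i \sum_j \sum_k u i * v j * w k * cos (al i + be j - ga k) <=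
  tnorm u al * (tnorm v be * tnorm w ga).
Proof.
set a := csum u al; set a' := ssum u al; set b := csum v be; set b' := ssum v be.
set c := csum w ga; set c' := ssum w ga.
have -> : \sum_i \sum_j \sum_k u i * v j * w k * cos (al i + be j - ga k) =
  a * (b * c + b' * c') + a' * (b * c' - b' * c).
  have e (F : J -> R) (G : K -> R) : (\sum_j F j) * (\sum_k G k) = \sum_j \sum_k F j * G k.
    by rewrite sumR_distrl; apply: eq_bigr => j _; rewrite sumR_distrr.
  have eX : b * c + b' * c' = \sum_j \sum_k v j * w k * cos (be j - ga k).
    rewrite /b /b' /c /c' /csum /ssum !e -big_split; apply: eq_bigr => j _ /=.
    by rewrite -big_split; apply: eq_bigr => k _ /=; rewrite cos_minus; ring.
  have eY : b * c' - b' * c = \sum_j \sum_k - (v j * w k * sin (be j - ga k)).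
    rewrite /b /b' /c /c' /csum /ssum !e -sumR_sub; apply: eq_bigr => j _ /=.
    by rewrite -sumR_sub; apply: eq_bigr => k _ /=; rewrite sin_minus; ring.
  rewrite eX eY /a /a' /csum /ssum !sumR_distrl -big_split; apply: eq_bigr => i _ /=.
  rewrite !sumR_distrr -big_split; apply: eq_bigr => j _ /=.
  rewrite !sumR_distrr -big_split; apply: eq_bigr => k _ /=.
  have -> : al i + be j - ga k = al i + (be j - ga k) by ring.
  by rewrite cos_plus; ring.
have h : 0 <= tnorm u al * (tnorm v be * tnorm w ga).
  by apply: Rmult_le_pos; [|apply: Rmult_le_pos]; exact: tnorm_ge0.
apply: (Rle_trans _ _ _ (Rle_abs _)); rewrite -(sqrt_pow2 _ h) -sqrt_Rsqr_abs.
apply: sqrt_le_1_alt; rewrite Rsqr_pow2 !Rpow_mult_distr !pow2_sqrt; try exact: sum_sqr_ge0.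
rewrite -/a -/a' -/b -/b' -/c -/c'.
have := pow2_ge_0 (a * (b * c' - b' * c) - a' * (b * c + b' * c')); nra.
Qed.

Definition fejer (L : nat) (w : R) : R :=
  tnorm (fun _ : 'I_L => 1) (fun a => INR a * w) ^ 2.

Lemma fejer_ge0 L w : 0 <= fejer L w.
Proof. exact: pow2_ge_0. Qed.

Lemma fejerE L w : fejer L w = \sum_(a < L) \sum_(b < L) cos ((INR a - INR b) * w).
Proof.
rewrite /fejer tnorm_sqr; apply: eq_bigr => a _; apply: eq_bigr => b _.
by rewrite Rmult_1_l Rmult_1_l; congr cos; ring.
Qed.

Lemma cos_add_period (x : R) (k : Z) : cos (x + IZR k * (2 * PI)) = cos x.
Proof.
case: (Z_le_gt_dec 0 k) => hk.
  rewrite -[in RHS](cos_period x (Z.to_nat k)) INR_IZR_INZ Z2Nat.id //; congr cos; ring.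
rewrite -(cos_period _ (Z.to_nat (- k))) INR_IZR_INZ Z2Nat.id; last by lia.
by rewrite opp_IZR; congr cos; ring.
Qed.

Lemma sin_add_period (x : R) (k : Z) : sin (x + IZR k * (2 * PI)) = sin x.
Proof.
rewrite -!cos_shift -[RHS](cos_add_period _ (- k)) opp_IZR; congr cos; ring.
Qed.

Lemma fejer_period L w k : fejer L (w + IZR k * (2 * PI)) = fejer L w.
Proof.
rewrite !fejerE; apply: eq_bigr => a _; apply: eq_bigr => b _.
rewrite -[in RHS](cos_add_period _ ((Z.of_nat a - Z.of_nat b) * k)).
rewrite mult_IZR minus_IZR -!INR_IZR_INZ; congr cos. ring.
Qed.

Lemma fejer_near0 L w : (0 < L)%N -> Rabs w <= PI / (3 * INR L) -> INR L ^ 2 / 4 <= fejer L w.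
Proof.
move=> L0 hw; have L0' : 0 < INR L by apply: lt_0_INR; exact/ltP.
have h : INR L / 2 <= csum (fun _ : 'I_L => 1) (fun a => INR a * w).
  have -> : INR L / 2 = \sum_(a < L) (1 / 2) by rewrite sumR_const card_ord; lra.
  apply: sumR_le => a _; rewrite Rmult_1_l -cos_PI3.
  have aL : INR a <= INR L by apply: le_INR; apply/leP; apply: ltnW; exact: ltn_ord.
  have pi := PI_RGT_0.
  have b : Rabs (INR a * w) <= PI / 3.
    rewrite Rabs_mult Rabs_pos_eq; last exact: pos_INR.
    apply: (Rle_trans _ (INR L * (PI / (3 * INR L)))).
      by apply: Rmult_le_compat => //; [exact: pos_INR|exact: Rabs_pos].
    by apply: Req_le; field; lra.
  have -> : cos (INR a * w) = cos (Rabs (INR a * w)).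
    by rewrite /Rabs; case: Rcase_abs => // _; rewrite cos_neg.
  by apply: cos_decr_1; try lra; have := Rabs_pos (INR a * w); lra.
rewrite /fejer pow2_sqrt; last exact: sum_sqr_ge0.
set s := ssum _ _; have := pow2_ge_0 s; nra.
Qed.

Lemma sum_cos_telescope Q w :
  2 * sin (w / 2) * (\sum_(a < Q) cos (INR a * w)) =
  sin ((INR Q - 1 / 2) * w) + sin (w / 2).
Proof.
elim: Q => [|Q IH].
  rewrite big_ord0 (_ : (INR 0 - 1 / 2) * w = - (w / 2)) ?sin_neg; last by rewrite /=; lra.
  by lra.
rewrite big_ord_recr /= Rmult_plus_distr_l IH -/(INR Q.+1) S_INR.
have -> : (INR Q + 1 - 1 / 2) * w = INR Q * w + w / 2 by lra.
have -> : (INR Q - 1 / 2) * w = INR Q * w - w / 2 by lra.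
by rewrite sin_plus sin_minus; ring.
Qed.

Lemma sum_sin_telescope Q w :
  2 * sin (w / 2) * (\sum_(a < Q) sin (INR a * w)) =
  cos (w / 2) - cos ((INR Q - 1 / 2) * w).
Proof.
elim: Q => [|Q IH].
  rewrite big_ord0 (_ : (INR 0 - 1 / 2) * w = - (w / 2)) ?cos_neg; last by rewrite /=; lra.
  by lra.
rewrite big_ord_recr /= Rmult_plus_distr_l IH -/(INR Q.+1) S_INR.
have -> : (INR Q + 1 - 1 / 2) * w = INR Q * w + w / 2 by lra.
have -> : (INR Q - 1 / 2) * w = INR Q * w - w / 2 by lra.
by rewrite cos_plus cos_minus; ring.
Qed.

(** Orthogonality of the characters modulo Q: at a nonzero multiple of 2 pi / Q
    the telescoping formulas for the sums of cosines and sines have equal ends. *)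
Lemma fejer_orthogonal (Q : nat) (x y : 'I_Q) :
  fejer Q (2 * PI / INR Q * (INR x - INR y)) = if x == y then INR Q ^ 2 else 0.
Proof.
case: eqP => [->|xy].
  rewrite fejerE Rminus_diag Rmult_0_r.
  under eq_bigr => a _ do under eq_bigr => b _ do rewrite Rmult_0_r cos_0.
  by rewrite !sumR_const card_ord; ring.
have Q0 : 0 < INR Q by apply: lt_0_INR; apply/ltP; apply: leq_trans (ltn_ord x).
set h := IZR (Z.of_nat x - Z.of_nat y).
have hE : INR x - INR y = h by rewrite /h minus_IZR -!INR_IZR_INZ.
set w := 2 * PI / INR Q * _.
have pi := PI_RGT_0.
have wE : w = PI * (2 * h / INR Q) by rewrite /w hE; field; lra.
have h0 : h <> 0.
  rewrite /h; apply: not_0_IZR => e; apply: xy; apply: val_inj => /=; lia.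
have hb : - INR Q < h < INR Q.
  rewrite -hE; have := pos_INR x; have := pos_INR y.
  have hx : INR x < INR Q by apply: lt_INR; apply/ltP; exact: ltn_ord.
  have hy : INR y < INR Q by apply: lt_INR; apply/ltP; exact: ltn_ord.
  lra.
have s0 : sin (w / 2) <> 0.
  have -> : w / 2 = PI * (h / INR Q) by rewrite wE; field; lra.
  have b1 : h / INR Q < 1 by apply: (Rmult_lt_reg_r (INR Q)) => //; field_simplify; lra.
  have b2 : -1 < h / INR Q by apply: (Rmult_lt_reg_r (INR Q)) => //; field_simplify; lra.
  case: (Rtotal_order h 0) => [hn|[//|hp]].
    have : h / INR Q < 0 by apply: Rdiv_neg_pos; lra.
    by move=> ?; apply: Rlt_not_eq; apply: sin_lt_0_var; nra.
  have : 0 < h / INR Q by apply: Rdiv_lt_0_compat; lra.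
  by move=> ?; apply: Rgt_not_eq; apply: sin_gt_0; nra.
have e : (INR Q - 1 / 2) * w = - (w / 2) + IZR (Z.of_nat x - Z.of_nat y) * (2 * PI).
  by rewrite -/h wE; field; lra.
have c0 : \sum_(a < Q) cos (INR a * w) = 0.
  have := sum_cos_telescope Q w; rewrite e sin_add_period sin_neg; nra.
have s0' : \sum_(a < Q) sin (INR a * w) = 0.
  by have := sum_sin_telescope Q w; rewrite e cos_add_period cos_neg; nra.
rewrite /fejer pow2_sqrt; last exact: sum_sqr_ge0.
rewrite /csum /ssum.
under eq_bigr => a _ do rewrite Rmult_1_l.
under [X in _ + X ^ 2]eq_bigr => a _ do rewrite Rmult_1_l.
by rewrite c0 s0'; ring.
Qed.


(** * The resonance inequality *)

(** Rounding of a frequency u, modulo 2 pi, to a multiple of 2 pi / Q. *)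
Lemma bucket_exists (Q : nat) (u : R) : (0 < Q)%N -> exists x : 'I_Q, exists k : Z,
  exists e : R, 0 <= e < 1 /\ u = 2 * PI / INR Q * (INR x + e) + IZR k * (2 * PI).
Proof.
move=> Q0; have Q0' : 0 < INR Q by apply: lt_0_INR; exact/ltP.
have pi := PI_RGT_0.
set v := INR Q * u / (2 * PI); set n := Int_part v.
have QZ : (0 < Z.of_nat Q)%Z by have /ltP := Q0; lia.
have hm := Z.mod_pos_bound n _ QZ.
have xQ : (Z.to_nat (n mod Z.of_nat Q) < Q)%N by apply/ltP; lia.
exists (Ordinal xQ), (n / Z.of_nat Q)%Z, (frac_part v).
split; first by have := base_fp v; lra.
have e1 : INR (Ordinal xQ) + IZR (n / Z.of_nat Q) * INR Q = IZR n.
  rewrite /= !INR_IZR_INZ Z2Nat.id; last by lia.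
  rewrite -mult_IZR -plus_IZR; congr IZR; have := Z.div_mod n (Z.of_nat Q); lia.
have e2 : v = IZR n + frac_part v by rewrite /frac_part -/n; ring.
have -> : u = 2 * PI / INR Q * v by rewrite /v; field; lra.
rewrite {1}e2 -e1; field; lra.
Qed.

Section Buckets.
Variables (U : finType) (Q : nat) (f : U -> R) (X : U -> 'I_Q).

(** Aggregating the coefficients of a bucket by their quadratic mean preserves
    the sum of squares and still dominates products along a matching. *)
Definition bucket (x : 'I_Q) : R := sqrt (\sum_(a | X a == x) f a ^ 2).

Lemma bucket_ge0 x : 0 <= bucket x. Proof. exact: sqrt_pos. Qed.

Lemma bucket_sqr x : bucket x ^ 2 = \sum_(a | X a == x) f a ^ 2.
Proof. by rewrite pow2_sqrt //; apply: sumR_ge0 => a _; exact: pow2_ge_0. Qed.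

Lemma sum_bucket_sqr : \sum_x bucket x ^ 2 = \sum_a f a ^ 2.
Proof.
rewrite [RHS](partition_big X xpredT) //=.
by apply: eq_bigr => x _; exact: bucket_sqr.
Qed.

Lemma sum_bucket_le : (forall a, 0 <= f a) -> \sum_x bucket x <= \sum_a f a.
Proof.
move=> f0; rewrite [X in _ <= X](partition_big X xpredT) //=.
apply: sumR_le => x _; apply: sqr_le_le; first exact: sumR_ge0.
rewrite bucket_sqr /= Rmult_1_r sumR_distrl; apply: sumR_le => a ax.
rewrite Rmult_1_r; apply: Rmult_le_compat_l => //.
exact: (@sumR_ge_term _ (fun a => X a == x)).
Qed.

(** Since |R(a-b)|^2 >= 0, the average over a, b < L may be extended to a, b < Q,
    where the rounded frequencies are exactly orthogonal. *)
Lemma bucket_mean_square L : (L <= Q)%N ->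
  \sum_(a < L) \sum_(b < L)
     tnorm bucket (fun x => (INR a - INR b) * (2 * PI / INR Q * INR x)) ^ 2
  <= INR Q ^ 2 * \sum_a f a ^ 2.
Proof.
move=> LQ; pose G (a b : nat) :=
  tnorm bucket (fun x => (INR a - INR b) * (2 * PI / INR Q * INR x)) ^ 2.
have G0 a b : 0 <= G a b by exact: pow2_ge_0.
rewrite -/(G _ _).
have step : \sum_(a < L) \sum_(b < L) G a b <= \sum_(a < Q) \sum_(b < Q) G a b.
  rewrite (big_ord_widen _ (fun a => \sum_(b < L) G a b) LQ).
  apply: (Rle_trans _ (\sum_(a < Q) \sum_(b < L) G a b)).
    by apply: sumR_le_cond => // a _; apply: sumR_ge0.
  apply: sumR_le => a _; rewrite (big_ord_widen _ (fun b => G a b) LQ).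
  by apply: sumR_le_cond.
apply: (Rle_trans _ _ _ step); apply: Req_le; rewrite /G.
transitivity (\sum_(a < Q) \sum_(b < Q) \sum_(x < Q) \sum_(y < Q)
    bucket x * bucket y * cos ((INR a - INR b) * (2 * PI / INR Q * INR x) -
                               (INR a - INR b) * (2 * PI / INR Q * INR y))).
  by apply: eq_bigr => a _; apply: eq_bigr => b _; rewrite tnorm_sqr.
transitivity (\sum_(x < Q) \sum_(y < Q) bucket x * bucket y *
     fejer Q (2 * PI / INR Q * (INR x - INR y))).
  rewrite [LHS]exchange_sum3; apply: eq_bigr => x _.
  rewrite [LHS]exchange_sum3; apply: eq_bigr => y _.
  rewrite fejerE sumR_distrr; apply: eq_bigr => a _.
  rewrite sumR_distrr; apply: eq_bigr => b _.
  by congr (_ * cos _); ring.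
rewrite -sum_bucket_sqr sumR_distrr; apply: eq_bigr => x _.
rewrite (bigD1 x) //= fejer_orthogonal eqxx big1 => [|y /negbTE yx].
  by ring.
by rewrite fejer_orthogonal eq_sym yx; ring.
Qed.
End Buckets.

(** The Cauchy-Schwarz inequality along the matching b |-> (h b, b) between two
    buckets: this is what the rounding of the frequencies does not lose. *)
Lemma bucket_matching (U W : finType) (Q : nat) (f : U -> R) (g : W -> R)
    (X : U -> 'I_Q) (Y : W -> 'I_Q) (C : pred W) (h : W -> U) x y :
  {in C &, injective h} -> 
  \sum_(b | C b && ((X (h b) == x) && (Y b == y))) f (h b) * g b <=
  bucket f X x * bucket g Y y.
Proof.
move=> hinj.
apply: (Rle_trans _ _ _ (cauchy_schwarz_sqrt _ _ _)).
apply: Rmult_le_compat; try exact: sqrt_pos; apply: sqrt_le_1_alt; last first.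
  apply: sumR_le_cond => [b /andP[_ /andP[]]|b _] //; exact: pow2_ge_0.
rewrite -(big_imset (fun a => f a ^ 2)) /=; last first.
  by move=> b b' /andP[hb _] /andP[hb' _]; apply: hinj.
apply: sumR_le_cond => [a /imsetP[b]|a _]; last exact: pow2_ge_0.
by rewrite unfold_in => /andP[_ /andP[hb _]] ->.
Qed.

Definition natdist (a b : nat) : nat := (a - b) + (b - a).

Lemma INR_natdist a b : INR (natdist a b) = Rabs (INR a - INR b).
Proof.
rewrite /natdist; case: (leqP a b) => [ab|/ltnW ab]; move: (ab); rewrite -subn_eq0 => /eqP ->.
  rewrite add0n minus_INR; last exact/leP.
  by rewrite Rabs_minus_sym Rabs_pos_eq //; have /leP/le_INR := ab; lra.
rewrite addn0 minus_INR; last exact/leP.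
by rewrite Rabs_pos_eq //; have /leP/le_INR := ab; lra.
Qed.

Lemma sum_natdist_le (L H : nat) (a : 'I_L) (D : nat -> R) : (forall t, 0 <= D t) ->
  \sum_(b < L | (natdist a b < H)%N) D (natdist a b) <= 2 * \sum_(t < H) D t.
Proof.
move=> D0.
have -> : \sum_(b < L | (natdist a b < H)%N) D (natdist a b) =
   \sum_(b < L) \sum_(t < H | natdist a b == t) D t.
  rewrite big_mkcond; apply: eq_bigr => b _; case: ifP => hb.
    by rewrite (big_pred1 (Ordinal hb)).
  by rewrite big_pred0 // => t; apply/eqP => e; move: (ltn_ord t); rewrite -e hb.
rewrite (exchange_big_dep xpredT) //= sumR_distrr; apply: sumR_le => t _.
rewrite sumR_const; apply: Rmult_le_compat_r => //.
rewrite -[2]/(INR 2); apply: le_INR; apply/leP.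
rewrite -card_bool -(@card_in_imset _ _ (fun b : 'I_L => (b <= a)%N)); first exact: max_card.
move=> b c; rewrite !unfold_in /natdist => /eqP hb /eqP hc hbc; apply: val_inj => /=.
by move: hb hc hbc; case: (leqP b a) => h1; case: (leqP c a) => h2 //; lia.
Qed.

(** The exponential sum with weights d and frequencies nu plays the role of D.  The
    indices in S0 select, through iota, the terms of it that are kept; for such an s,
    the elements b satisfying C s are those divisible by s, and h s b is the
    quotient. *)
Section Resonance.
Variables (S S0 U W : finType) (d nu : S -> R) (P0 : pred S0) (iota : S0 -> S).
Variables (f u : U -> R) (g w : W -> R) (C : S0 -> pred W) (h : S0 -> W -> U).
Variables (L H : nat) (mx : R).
Hypothesis L_gt0 : (0 < L)%N.
Hypothesis d_ge0 : forall s, 0 <= d s.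
Hypothesis f_ge0 : forall a, 0 <= f a.
Hypothesis g_ge0 : forall b, 0 <= g b.
Hypothesis f_norm : \sum_a f a ^ 2 = 1.
Hypothesis g_norm : \sum_b g b ^ 2 = 1.
Hypothesis iota_inj : {in P0 &, injective iota}.
Hypothesis h_inj : forall s, P0 s -> {in C s &, injective (h s)}.
Hypothesis freq : forall s b, P0 s -> C s b -> u (h s b) + nu (iota s) = w b.
Hypothesis mx_ge0 : 0 <= mx.
Hypothesis mx_max : forall t : nat, (H <= t < L)%N ->
  tnorm d (fun s => INR t * nu s) <= mx.

(** Expand the average V of Re (D R1 conj(R2)) over t = a - b in two ways: all
    its Fejer kernels are nonnegative, and it is bounded pointwise by |D||R1||R2|. *)
Theorem resonance :
  (\sum_(s | P0 s) \sum_(b | C s b) d (iota s) * (f (h s b) * g b)) / 4 <=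
  36 * mx + 2 / INR L * (\sum_a f a) * (\sum_b g b) *
     \sum_(t < H) tnorm d (fun s => INR t * nu s).
Proof.
have L0 : 0 < INR L by apply: lt_0_INR; exact/ltP.
have pi := PI_RGT_0.
(* with buckets of length pi / (3L) rounding moves a frequency so little that
   a w stays in [-pi/3, pi/3] for a < L, where the cosine is at least 1/2 *)
set Q := (6 * L)%N.
have Q_gt0 : (0 < Q)%N by rewrite muln_gt0.
have QE : INR Q = 6 * INR L by rewrite /Q mult_INR /=; lra.
have [X hX] := fin_all_exists (fun a => bucket_exists (u a) Q_gt0).
have [Y hY] := fin_all_exists (fun b => bucket_exists (w b) Q_gt0).
pose rho := bucket f X; pose sig := bucket g Y.
have rho0 x : 0 <= rho x := bucket_ge0 f X x.
have sig0 y : 0 <= sig y := bucket_ge0 g Y y.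
pose th (x : 'I_Q) := 2 * PI / INR Q * INR x.
pose D (t : nat) := tnorm d (fun s => INR t * nu s).
have D0 t : 0 <= D t by exact: tnorm_ge0.
pose V := \sum_(a < L) \sum_(b < L) \sum_s \sum_x \sum_y d s * rho x * sig y *
  cos ((INR a - INR b) * nu s + (INR a - INR b) * th x - (INR a - INR b) * th y).
have VE : V = \sum_s \sum_x \sum_y d s * rho x * sig y * fejer L (nu s + th x - th y).
  rewrite /V [LHS]exchange_sum3; apply: eq_bigr => s _.
  rewrite [LHS]exchange_sum3; apply: eq_bigr => x _.
  rewrite [LHS]exchange_sum3; apply: eq_bigr => y _.
  rewrite fejerE sumR_distrr; apply: eq_bigr => a _.
  rewrite sumR_distrr; apply: eq_bigr => b _.
  by congr (_ * cos _); ring.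
have lower : INR L ^ 2 / 4 *
   (\sum_(s | P0 s) \sum_(b | C s b) d (iota s) * (f (h s b) * g b)) <= V.
  rewrite VE; pose T s := \sum_x \sum_y d s * rho x * sig y * fejer L (nu s + th x - th y).
  have T0 s : 0 <= T s.
    apply: sumR_ge0 => x _; apply: sumR_ge0 => y _.
    apply: Rmult_le_pos; last exact: fejer_ge0.
    by apply: Rmult_le_pos => //; apply: Rmult_le_pos.
  apply: (Rle_trans _ (\sum_(s | P0 s) T (iota s))); last first.
    rewrite -(big_imset T) /=; last exact: iota_inj.
    by apply: sumR_le_cond.
  rewrite sumR_distrr; apply: sumR_le => s Ps.
  rewrite (partition_big (fun b => X (h s b)) xpredT) //= sumR_distrr.
  apply: sumR_le => x _.
  rewrite (partition_big Y xpredT) //= sumR_distrr.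
  apply: sumR_le => y _.
  case: (pickP (fun b => C s b && ((X (h s b) == x) && (Y b == y)))) => [b|none]; last first.
    rewrite big_pred0 => [|b]; last by rewrite -andbA none.
    rewrite Rmult_0_r; apply: Rmult_le_pos; last exact: fejer_ge0.
    by apply: Rmult_le_pos => //; apply: Rmult_le_pos.
  move=> /andP[Cb /andP[/eqP Xb /eqP Yb]].
  have hf : INR L ^ 2 / 4 <= fejer L (nu (iota s) + th x - th y).
    have [k [e [he ue]]] := hX (h s b); have [k' [e' [he' we]]] := hY b.
    have := freq Ps Cb; rewrite ue we Xb Yb -/(th x) => fr.
    have -> : nu (iota s) + th x - th y = 2 * PI / INR Q * (e' - e) + IZR (k' - k) * (2 * PI).
      rewrite minus_IZR /th; lra.
    rewrite fejer_period; apply: fejer_near0 => //.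
    rewrite QE Rabs_mult Rabs_pos_eq; last by apply: Rdiv_le_0_compat; lra.
    have -> : PI / (3 * INR L) = 2 * PI / (6 * INR L) * 1 by field; lra.
    apply: Rmult_le_compat_l; first by apply: Rdiv_le_0_compat; lra.
    by apply: Rabs_le; lra.
  have hb := bucket_matching f g X Y x y (h_inj Ps).
  under eq_bigl => i do rewrite -andbA.
  rewrite -sumR_distrr.
  apply: (Rle_trans _ (INR L ^ 2 / 4 * (d (iota s) * (rho x * sig y)))).
    apply: Rmult_le_compat_l; first by have := pow2_ge_0 (INR L); lra.
    exact: Rmult_le_compat_l.
  rewrite Rmult_comm -Rmult_assoc; apply: Rmult_le_compat_l => //.
  by apply: Rmult_le_pos => //; apply: Rmult_le_pos.
have upper : V <= INR L * (2 * \sum_(t < H) D t) * ((\sum_a f a) * (\sum_b g b)) +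
   mx * INR Q ^ 2.
  pose tr (a b : nat) := tnorm rho (fun x => (INR a - INR b) * th x).
  pose ts (a b : nat) := tnorm sig (fun x => (INR a - INR b) * th x).
  have F0 : 0 <= \sum_a f a by exact: sumR_ge0.
  have G0 : 0 <= \sum_b g b by exact: sumR_ge0.
  apply: (Rle_trans _ (\sum_(a < L) \sum_(b < L)
      ((if (natdist a b < H)%N then D (natdist a b) else 0) * ((\sum_a f a) * (\sum_b g b)) +
       mx / 2 * (tr a b ^ 2 + ts a b ^ 2)))).
    apply: sumR_le => a _; apply: sumR_le => b _.
    apply: (Rle_trans _ _ _ (trig_sum3_le _ _ _ _ _ _)).
    have -> : tnorm d (fun s => (INR a - INR b) * nu s) = D (natdist a b).
      rewrite /D INR_natdist; case: (Rle_dec 0 (INR a - INR b)) => ab.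
        by rewrite Rabs_pos_eq.
      rewrite Rabs_left; last by lra.
      rewrite -tnormN /tnorm; congr sqrt; congr (_ ^ 2 + _ ^ 2);
       by apply: eq_bigr => i _; rewrite -Ropp_mult_distr_l.
    rewrite -/(tr a b) -/(ts a b).
    have r0 : 0 <= tr a b by exact: tnorm_ge0.
    have s0 : 0 <= ts a b by exact: tnorm_ge0.
    have sq := sum_sqr_ge0 (tr a b) (ts a b).
    case: ifP => hH.
      have : tr a b * ts a b <= (\sum_a f a) * (\sum_b g b).
        apply: Rmult_le_compat => //.
          exact: (Rle_trans _ _ _ (tnorm_le_sum _ rho0) (sum_bucket_le X f_ge0)).
        exact: (Rle_trans _ _ _ (tnorm_le_sum _ sig0) (sum_bucket_le Y g_ge0)).
      have := D0 (natdist a b) => dn hh.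
      have := Rmult_le_compat_l _ _ _ dn hh; nra.
    rewrite Rmult_0_l Rplus_0_l.
    have Dm : D (natdist a b) <= mx.
      apply: mx_max; rewrite leqNgt hH /=.
      by rewrite /natdist; have := ltn_ord a; have := ltn_ord b; lia.
    have := pow2_ge_0 (tr a b - ts a b) => sq2.
    apply: (Rle_trans _ (mx * (tr a b * ts a b))).
      by apply: Rmult_le_compat_r => //; apply: Rmult_le_pos.
    nra.
  set FG := (\sum_a f a) * (\sum_b g b).
  apply: (Rle_trans _ (\sum_(a < L) ((2 * \sum_(t < H) D t) * FG) +
     mx / 2 * (\sum_(a < L) \sum_(b < L) tr a b ^ 2 + \sum_(a < L) \sum_(b < L) ts a b ^ 2))).
    rewrite -sumR_add sumR_distrr -sumR_add; apply: sumR_le => a _ /=.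
    rewrite sumR_add -sumR_distrr sumR_add; apply: Rplus_le_compat_r.
    rewrite -sumR_distrl -big_mkcond /=; apply: Rmult_le_compat_r; first exact: Rmult_le_pos.
    exact: sum_natdist_le.
  apply: Rplus_le_compat.
    by rewrite sumR_const card_ord; apply: Req_le; ring.
  have LQ : (L <= Q)%N by rewrite /Q leq_pmull.
  have := bucket_mean_square f X LQ; have := bucket_mean_square g Y LQ.
  rewrite f_norm g_norm => h1 h2.
  apply: (Rle_trans _ (mx / 2 * (INR Q ^ 2 * 1 + INR Q ^ 2 * 1))); last by lra.
  apply: Rmult_le_compat_l; first by lra.
  exact: Rplus_le_compat.
have := Rle_trans _ _ _ lower upper; rewrite QE => fin.
rewrite -[\sum_(t < H) _]/(\sum_(t < H) D t).
apply: (Rmult_le_reg_l (INR L ^ 2)); first by apply: pow_lt.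
apply: (Rle_trans _ _ _ _ (Rle_trans _ _ _ fin _)).
  by apply: Req_le; field.
by apply: Req_le; field; lra.
Qed.
End Resonance.


(** * First order Euler-Maclaurin summation *)

Lemma one_minus_cos_le y : 0 <= 1 - cos y <= y ^ 2 / 2.
Proof.
split; first by have := COS_bound y; lra.
have -> : cos y = 1 - 2 * sin (y / 2) * sin (y / 2).
  by rewrite -cos_2a_sin; congr cos; lra.
have : sin (y / 2) ^ 2 <= (y / 2) ^ 2; last by nra.
have pos x : 0 <= x -> sin x ^ 2 <= x ^ 2.
  move=> x0; have h1 : sin x <= x.
    by case: (Req_dec x 0) => [->|x1]; [rewrite sin_0; lra|left; apply: sin_lt_x; lra].
  case: (Rle_dec x 1) => x1.
    have : 0 <= sin x by apply: sin_ge_0 => //; have := PI2_1; lra.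
    by nra.
  by have := SIN_bound x; nra.
case: (Rle_dec 0 (y / 2)) => h; first exact: pos.
have := pos (- (y / 2)); rewrite sin_neg => /(_ ltac:(lra)); nra.
Qed.

Lemma y_minus_sin_le y : 0 <= y -> 0 <= y - sin y <= y ^ 2.
Proof.
move=> y0; split.
  case: (Req_dec y 0) => [->|y1]; first by rewrite sin_0; lra.
  by have := sin_lt_x y; lra.
case: (Rle_dec y 1) => y1.
  have := sin_bound y 0 y0 ltac:(have := PI2_1; lra).
  rewrite /sin_approx /sin_term /= => -[h _]; nra.
case: (Rle_dec y 2) => y2; last by have := SIN_bound y; nra.
have : 0 <= sin y by apply: sin_ge_0 => //; have := PI2_1; lra.
nra.
Qed.

Lemma exp_le_quadratic x : 0 <= x <= 1 / 2 -> exp x <= 1 + x + 2 * x ^ 2.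
Proof.
move=> hx; have h := exp_ineq1_le (- x); have e0 := exp_pos x.
have e1 : exp x * exp (- x) = 1 by rewrite -exp_plus Rplus_opp_r exp_0.
have h2 : exp x * (1 - x) <= 1 by nra.
have h3 : 1 <= (1 + x + 2 * x ^ 2) * (1 - x) by nra.
by apply: (Rmult_le_reg_r (1 - x)); lra.
Qed.


Definition cis (y : R) : C := (cos y, sin y).

Lemma cis_add a b : cis (a + b) = Cmult (cis a) (cis b).
Proof. by rewrite /cis /Cmult cos_plus sin_plus /=; congr pair; ring. Qed.

Lemma Cmod_cis y : Cmod (cis y) = 1.
Proof.
rewrite /Cmod /= !Rmult_1_r -sqrt_1; congr sqrt.
by have := sin2_cos2 y; rewrite /Rsqr; lra.
Qed.

Lemma Cmod_le_add (z : C) : Cmod z <= Rabs (fst z) + Rabs (snd z).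
Proof.
case: z => a b /=; rewrite /Cmod /=.
apply: sqr_le_le; first by have := Rabs_pos a; have := Rabs_pos b; lra.
rewrite pow2_sqrt; last by have := sum_sqr_ge0 a b; rewrite /=; lra.
have ha : a * (a * 1) = Rabs a ^ 2 by rewrite pow2_abs /=.
have hb : b * (b * 1) = Rabs b ^ 2 by rewrite pow2_abs /=.
by rewrite ha hb; have := Rabs_pos a; have := Rabs_pos b; nra.
Qed.

(** e^w = 1 + w + O(|w|^2) for w = x + iy. *)
Lemma cexp_taylor x y : 0 <= x <= 1 / 2 -> 0 <= y ->
  Cmod (Cminus (Cmult (RtoC (exp x)) (cis y)) (1 + x, y)) <= 3 * (x ^ 2 + y ^ 2).
Proof.
move=> hx hy; apply: (Rle_trans _ _ _ (Cmod_le_add _)) => /=.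
have e1 : 1 + x <= exp x by exact: exp_ineq1_le.
have e2 := exp_le_quadratic hx.
have [c1 c2] := one_minus_cos_le y; have [s1 s2] := y_minus_sin_le hy.
have sb := SIN_bound y.
have re : Rabs (exp x * cos y - 0 * sin y + - (1 + x)) <= 2 * x ^ 2 + y ^ 2.
  have : 0 <= exp x * (1 - cos y) <= 2 * (y ^ 2 / 2).
    split; first by apply: Rmult_le_pos; lra.
    by apply: Rmult_le_compat; nra.
  by move=> ?; apply: Rabs_le; nra.
have im : Rabs (exp x * sin y + 0 * cos y + - y) <= 2 * x * y + y ^ 2.
  have : - (2 * x * y) <= (exp x - 1) * sin y <= 2 * x * y.
    have a1 : 0 <= exp x - 1 <= 2 * x by nra.
    case: (Rle_dec 0 (sin y)) => sy.
      have : 0 <= (exp x - 1) * sin y by apply: Rmult_le_pos; lra.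
      have : (exp x - 1) * sin y <= (2 * x) * y by apply: Rmult_le_compat; lra.
      by nra.
    have y1 : 1 <= y.
      case: (Rle_dec 1 y) => // y1; case: sy; apply: sin_ge_0; first by lra.
      by have := PI2_1; lra.
    have : (exp x - 1) * (- sin y) <= (2 * x) * y by apply: Rmult_le_compat; lra.
    have : 0 <= (exp x - 1) * (- sin y) by apply: Rmult_le_pos; lra.
    by nra.
  by move=> ?; apply: Rabs_le; nra.
have := pow2_ge_0 (x - y); nra.
Qed.

Definition dweight (m : nat) (i : 'I_m) : R := / sqrt (INR i.+1).
Definition dfreq (m : nat) (i : 'I_m) : R := ln (INR i.+1).
Definition dnorm (m : nat) (t : R) : R := tnorm (@dweight m) (fun i => t * dfreq i).
Definition dsum (m : nat) (t : R) : C :=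
  (csum (@dweight m) (fun i => t * dfreq i), ssum (@dweight m) (fun i => t * dfreq i)).

Lemma Cmod_dsum m t : Cmod (dsum m t) = dnorm m t. Proof. by []. Qed.

Lemma dsum_recr m t : dsum m.+1 t =
  Cplus (dsum m t) (Cmult (RtoC (/ sqrt (INR m.+1))) (cis (t * ln (INR m.+1)))).
Proof.
rewrite /dsum /csum /ssum !big_ord_recr /Cplus /Cmult /= -/(INR m.+1) /dweight /dfreq /=.
by congr pair; congr (_ + _); ring.
Qed.

(** [dsum] carries n^(it) and not n^(-it): the two sums are complex conjugates. *)
Lemma zeta_sum_norm M t : Cmod (zeta_sum M t) = dnorm (Z.to_nat (Int_part M)) t.
Proof.
rewrite /zeta_sum; set m := Z.to_nat _.
suff -> : sum_n_m (fun n : nat => nat_Cpower n (RtoC (- (1 / 2)) - Ci * RtoC t)%C) 1 m =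
  Cconj (dsum m t) by rewrite Cmod_conj.
elim: m => [|m IH].
  rewrite sum_n_m_zero; last by lia.
  by rewrite /dsum /csum /ssum !big_ord0 /Cconj /= Ropp_0.
rewrite sum_n_Sm; last by lia.
have n0 : 0 < INR m.+1 by apply: lt_0_INR; lia.
have -> : nat_Cpower m.+1 (RtoC (- (1 / 2)) - Ci * RtoC t)%C =
  (/ sqrt (INR m.+1) * cos (t * ln (INR m.+1)), - (/ sqrt (INR m.+1) * sin (t * ln (INR m.+1)))).
  rewrite /nat_Cpower /Cexp; set l := ln (INR m.+1).
  have -> : Re ((RtoC (- (1 / 2)) - Ci * RtoC t) * RtoC l)%C = - (/ 2 * l).
    by rewrite /Re /=; field.
  have -> : Im ((RtoC (- (1 / 2)) - Ci * RtoC t) * RtoC l)%C = - (t * l).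
    by rewrite /Im /=; ring.
  rewrite cos_neg sin_neg exp_Ropp /l -/(Rpower _ _) Rpower_sqrt //.
  by congr pair; ring.
rewrite IH dsum_recr /Cconj /plus /= /Cplus /= -/(INR m.+1).
by congr pair; ring.
Qed.


Lemma INR_S_gt0 n : 0 < INR n.+1.
Proof. by apply: lt_0_INR; lia. Qed.

Lemma INR_S_ge1 n : 1 <= INR n.+1.
Proof. by rewrite S_INR; have := pos_INR n; lra. Qed.

Definition nfloor (t : R) : nat := Z.to_nat (Int_part t).

Lemma nfloorP t : 0 <= t -> INR (nfloor t) <= t < INR (nfloor t) + 1.
Proof.
move=> t0; have [h1 h2] := base_Int_part t.
have h : (0 <= Int_part t)%Z by have : (-1 < Int_part t)%Z; [apply: lt_IZR; lra|lia].
by rewrite /nfloor INR_IZR_INZ Z2Nat.id //; lra.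
Qed.

Lemma ln_le_pred (r : R) : 0 < r -> ln r <= r - 1.
Proof. by move=> r0; have := exp_ineq1_le (ln r); rewrite exp_ln //; lra. Qed.

Lemma ln_succ_bound (r : R) : 1 <= r -> / (r + 1) <= ln (r + 1) - ln r <= / r.
Proof.
move=> r1; rewrite -ln_div; try lra; split; last first.
  apply: (Rle_trans _ _ _ (ln_le_pred _)); first by apply: Rdiv_lt_0_compat; lra.
  by apply: Req_le; field; lra.
have -> : ln ((r + 1) / r) = - ln (r / (r + 1)).
  by rewrite -ln_Rinv; [congr ln; field; lra|apply: Rdiv_lt_0_compat; lra].
have h : 0 < r / (r + 1) by apply: Rdiv_lt_0_compat; lra.
have := ln_le_pred h; have : r / (r + 1) = 1 - / (r + 1) by field; lra.
lra.
Qed.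

(** n^(1/2+it), a primitive of (1/2+it) n^(-1/2+it). *)
Definition cpow_half (t : R) (n : nat) : C := Cmult (RtoC (sqrt (INR n))) (cis (t * ln (INR n))).

Lemma Cmod_cpow_half t n : Cmod (cpow_half t n) = sqrt (INR n).
Proof. by rewrite /cpow_half Cmod_mult Cmod_cis Cmod_R Rabs_pos_eq ?Rmult_1_r //; exact: sqrt_pos. Qed.

(** The increment of n^(1/2+it) is n^(1/2+it) (e^w - 1) with w = (1/2+it) log(1+1/n),
    and both e^w - 1 - w and w - (1/2+it)/n are O((1+t^2)/n^2). *)
Lemma cpow_half_step t n : 0 <= t ->
  Cmod (Cminus (Cminus (cpow_half t n.+2) (cpow_half t n.+1))
    (Cmult (1 / 2, t) (Cmult (RtoC (/ sqrt (INR n.+1))) (cis (t * ln (INR n.+1))))))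
  <= 4 * (1 + t ^ 2) * (sqrt (INR n.+1) / INR n.+1 ^ 2).
Proof.
move=> t0; set r := INR n.+1; have r1 : 1 <= r := INR_S_ge1 n.
have rS : INR n.+2 = r + 1 by rewrite S_INR.
have sr : 0 < sqrt r by apply: sqrt_lt_R0; lra.
have [z1 z2] := ln_succ_bound r1; set z := ln (r + 1) - ln r in z1 z2.
have zd : - / r ^ 2 <= z - / r <= 0.
  split; last by lra.
  have : / r - / (r + 1) <= / r ^ 2.
    have -> : / r - / (r + 1) = / (r * (r + 1)) by field; lra.
    by apply: Rinv_le_contravar; nra.
  lra.
have z0 : 0 <= z by apply: Rle_trans z1; left; apply: Rinv_0_lt_compat; lra.
have e1 : cpow_half t n.+2 = Cmult (cpow_half t n.+1) (Cmult (RtoC (exp (z / 2))) (cis (t * z))).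
  rewrite /cpow_half rS -/r.
  have -> : t * ln (r + 1) = t * ln r + t * z by rewrite /z; ring.
  have -> : sqrt (r + 1) = sqrt r * exp (z / 2).
    rewrite -!Rpower_sqrt; try lra.
    by rewrite /Rpower -exp_plus /z; congr exp; field.
  by rewrite cis_add RtoC_mult; ring.
have e2 : Cmult (RtoC (/ sqrt r)) (cis (t * ln r)) = Cmult (cpow_half t n.+1) (RtoC (/ r)).
  have -> : / sqrt r = sqrt r * / r.
    by rewrite -{3}(sqrt_sqrt r); [field; lra|lra].
  by rewrite /cpow_half -/r RtoC_mult; ring.
rewrite e1 e2.
have -> : Cminus (Cminus (Cmult (cpow_half t n.+1) (Cmult (RtoC (exp (z / 2))) (cis (t * z)))) (cpow_half t n.+1))
   (Cmult (1 / 2, t) (Cmult (cpow_half t n.+1) (RtoC (/ r)))) =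
   Cmult (cpow_half t n.+1)
    (Cplus (Cminus (Cmult (RtoC (exp (z / 2))) (cis (t * z))) (1 + z / 2, t * z))
           (Cmult (1 / 2, t) (RtoC (z - / r)))).
  have -> : (1 + z / 2, t * z) = Cplus (RtoC 1) (Cmult (1 / 2, t) (RtoC z)).
    by rewrite /Cplus /Cmult /RtoC /=; congr pair; field.
  by rewrite RtoC_minus; ring.
rewrite Cmod_mult Cmod_cpow_half -/r.
apply: (Rle_trans _ (sqrt r * (4 * (1 + t ^ 2) * / r ^ 2))); last by apply: Req_le; field; lra.
apply: Rmult_le_compat_l; first by lra.
apply: (Rle_trans _ _ _ (Cmod_triangle _ _)).
have ir : 0 < / r by apply: Rinv_0_lt_compat; lra.
have ir1 : / r <= 1 by rewrite -Rinv_1; apply: Rinv_le_contravar; lra.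
have h1 := @cexp_taylor (z / 2) (t * z) ltac:(lra) ltac:(nra).
have z2' : z ^ 2 <= / r ^ 2 by rewrite -pow_inv; apply: pow_incr; lra.
have h2 : Cmod (Cmult (1 / 2, t) (RtoC (z - / r))) <= (1 / 2 + t) * / r ^ 2.
  rewrite Cmod_mult Cmod_R; apply: Rmult_le_compat; [exact: Cmod_ge_0|exact: Rabs_pos| |].
    by apply: (Rle_trans _ _ _ (Cmod_le_add _)); rewrite /= !Rabs_pos_eq; lra.
  by apply: Rabs_le; lra.
have i2 : 0 < / r ^ 2 by apply: Rinv_0_lt_compat; nra.
have h3 : 3 * ((z / 2) ^ 2 + (t * z) ^ 2) <= 3 * (1 / 4 + t ^ 2) * / r ^ 2.
  have -> : 3 * ((z / 2) ^ 2 + (t * z) ^ 2) = 3 * (1 / 4 + t ^ 2) * z ^ 2 by field.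
  by apply: Rmult_le_compat_l => //; nra.
have h4 : (3 * (1 / 4 + t ^ 2) + (1 / 2 + t)) * / r ^ 2 <= 4 * (1 + t ^ 2) * / r ^ 2.
  by apply: Rmult_le_compat_r; nra.
lra.
Qed.

Lemma inv_sqrt_telescope (r : R) : 1 <= r ->
  sqrt r / r ^ 2 <= 4 * (/ sqrt r - / sqrt (r + 1)).
Proof.
move=> r1; set a := sqrt r; set b := sqrt (r + 1).
have a0 : 0 < a by apply: sqrt_lt_R0; lra.
have b0 : 0 < b by apply: sqrt_lt_R0; lra.
have a2 : r = a ^ 2 by rewrite pow2_sqrt //; lra.
have b2 : b ^ 2 = a ^ 2 + 1 by rewrite -a2 pow2_sqrt //; lra.
have ab : b <= 3 / 2 * a by apply: sqr_le_le; nra.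
have -> : a / r ^ 2 = / a ^ 3 by rewrite a2; field; lra.
have -> : / a - / b = / (a * b * (a + b)).
  have -> : / a - / b = (b ^ 2 - a ^ 2) / (a * b * (a + b)) by field; lra.
  by rewrite b2; field; split; [lra|split; nra].
have p0 : 0 < a * b * (a + b) by apply: Rmult_lt_0_compat; nra.
apply: (Rmult_le_reg_r (a ^ 3 * (a * b * (a + b)))).
  by apply: Rmult_lt_0_compat => //; apply: pow_lt.
have -> : / a ^ 3 * (a ^ 3 * (a * b * (a + b))) = a * (b * (a + b)) by field; lra.
have -> : 4 * / (a * b * (a + b)) * (a ^ 3 * (a * b * (a + b))) = a * (4 * a ^ 2).
  by field; split; [lra|split; nra].
by apply: Rmult_le_compat_l; nra.
Qed.

Lemma dsum_euler_maclaurin t N m : 0 <= t -> (N <= m)%N ->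
  Cmod (Cminus (Cminus (cpow_half t m.+1) (cpow_half t N.+1))
    (Cmult (1 / 2, t) (Cminus (dsum m t) (dsum N t))))
  <= 16 * (1 + t ^ 2) * (/ sqrt (INR N.+1) - / sqrt (INR m.+1)).
Proof.
move=> t0; elim: m => [|m IH].
  rewrite leqn0 => /eqP ->; rewrite (_ : Cminus _ _ = RtoC 0) ?Cmod_0; first by lra.
  by rewrite /Cminus !Cplus_opp_r Cmult_0_r; ring.
rewrite leq_eqVlt => /orP[/eqP <-|].
  rewrite (_ : Cminus _ _ = RtoC 0) ?Cmod_0; first by lra.
  by ring.
rewrite ltnS => /IH {}IH; rewrite dsum_recr.
set v := Cmult (RtoC (/ sqrt _)) _.
have -> : Cminus (Cminus (cpow_half t m.+2) (cpow_half t N.+1))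
    (Cmult (1 / 2, t) (Cminus (Cplus (dsum m t) v) (dsum N t))) =
  Cplus (Cminus (Cminus (cpow_half t m.+1) (cpow_half t N.+1))
    (Cmult (1 / 2, t) (Cminus (dsum m t) (dsum N t))))
   (Cminus (Cminus (cpow_half t m.+2) (cpow_half t m.+1)) (Cmult (1 / 2, t) v)) by ring.
apply: (Rle_trans _ _ _ (Cmod_triangle _ _)).
have h1 := cpow_half_step m t0; have h2 := inv_sqrt_telescope (INR_S_ge1 m).
rewrite -/v in h1; rewrite -S_INR in h2.
have t2 : 0 <= 4 * (1 + t ^ 2) by nra.
have := Rmult_le_compat_l _ _ _ t2 h2; lra.
Qed.

Lemma dnorm_ge0 m t : 0 <= dnorm m t. Proof. exact: tnorm_ge0. Qed.

Lemma dnorm_le_trivial m t : dnorm m t <= 2 * sqrt (INR m).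
Proof.
apply: (Rle_trans _ (\sum_(i < m) @dweight m i)).
  by apply: tnorm_le_sum => i; left; apply: Rinv_0_lt_compat; apply: sqrt_lt_R0; exact: INR_S_gt0.
elim: m => [|m IH]; first by rewrite big_ord0 sqrt_0; lra.
rewrite big_ord_recr /= /dweight [nat_of_ord _]/=.
suff : / sqrt (INR m.+1) <= 2 * sqrt (INR m.+1) - 2 * sqrt (INR m).
  by move: IH; rewrite /dweight -/(INR m.+1) /=; lra.
rewrite S_INR; set b := sqrt (INR m + 1); set a := sqrt (INR m).
have m0 := pos_INR m.
have a0 : 0 <= a := sqrt_pos _.
have b0 : 0 < b by apply: sqrt_lt_R0; lra.
have a2 : a ^ 2 = INR m by rewrite pow2_sqrt.
have b2 : b ^ 2 = INR m + 1 by rewrite pow2_sqrt //; lra.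
apply: (Rmult_le_reg_r b) => //; rewrite Rinv_l; last by lra.
have := pow2_ge_0 (a - b); nra.
Qed.

(** Comparison at N = floor t: there the error t / sqrt N of the summation formula,
    after division by t, balances the trivial bound 2 sqrt N. *)
Lemma dsum_compare t N m : 1 <= t -> INR N <= t -> t < INR N + 1 -> (N <= m)%N ->
  sqrt (INR m.+1) - 34 * (t * sqrt t) <= Cmod (1 / 2, t) * Cmod (Cminus (dsum m t) (dsum N t)) <=
  sqrt (INR m.+1) + 34 * (t * sqrt t).
Proof.
move=> t1 Nt tN Nm; have t0 : 0 <= t by lra.
have h := dsum_euler_maclaurin t0 Nm.
rewrite -Cmod_mult; set z := Cmult _ _; rewrite -/z in h.
set A := cpow_half t m.+1 in h; set B := cpow_half t N.+1 in h.
have hA : Cmod A = sqrt (INR m.+1) by exact: Cmod_cpow_half.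
have hB : Cmod B <= 2 * (t * sqrt t).
  rewrite Cmod_cpow_half S_INR; apply: (Rle_trans _ (sqrt (4 * t))).
    by apply: sqrt_le_1_alt; lra.
  rewrite sqrt_mult; try lra.
  have -> : sqrt 4 = 2 by rewrite (_ : 4 = 2 ^ 2); [rewrite sqrt_pow2; lra|ring].
  by have := sqrt_pos t; nra.
have st : 0 < sqrt t by apply: sqrt_lt_R0; lra.
have hC : 16 * (1 + t ^ 2) * (/ sqrt (INR N.+1) - / sqrt (INR m.+1)) <= 32 * (t * sqrt t).
  have i1 : 0 < / sqrt (INR m.+1) by apply: Rinv_0_lt_compat; apply: sqrt_lt_R0; exact: INR_S_gt0.
  have i2 : / sqrt (INR N.+1) <= / sqrt t.
    by apply: Rinv_le_contravar => //; rewrite S_INR; apply: sqrt_le_1_alt; lra.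
  apply: (Rle_trans _ (32 * t ^ 2 * / sqrt t)).
    by apply: Rmult_le_compat; try nra; rewrite -(Rplus_opp_r (/ sqrt (INR m.+1)));
       apply: Rplus_le_compat_r; apply: Rinv_le_contravar; 
       [apply: sqrt_lt_R0; exact: INR_S_gt0|apply: sqrt_le_1_alt; apply: le_INR; lia].
  have -> : t ^ 2 = t * (sqrt t * sqrt t) by rewrite sqrt_sqrt //; ring.
  by apply: Req_le; field; lra.
have a1 := Cmod_triangle (Cminus (Cminus A B) z) (Cplus z B).
have a2 := Cmod_triangle z B.
have e1 : Cplus (Cminus (Cminus A B) z) (Cplus z B) = A by ring.
rewrite e1 in a1.
have a3 := Cmod_triangle (Cminus A B) (Copp (Cminus (Cminus A B) z)).
have e2 : Cplus (Cminus A B) (Copp (Cminus (Cminus A B) z)) = z by ring.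
rewrite e2 Cmod_opp in a3.
have a4 := Cmod_triangle A (Copp B); rewrite Cmod_opp in a4.
rewrite -/(Cminus A B) in a4.
split; lra.
Qed.

Lemma Cmod_half_bounds t : 1 <= t -> t <= Cmod (1 / 2, t) <= 2 * t.
Proof.
move=> t1; split.
  by have := Rmax_Cmod (1 / 2, t); rewrite /= => h; have := Rmax_r (Rabs (1 / 2)) (Rabs t);
  have := Rle_abs t; lra.
by apply: (Rle_trans _ _ _ (Cmod_le_add _)); rewrite /= !Rabs_pos_eq; lra.
Qed.

Lemma dnorm_le_of_floor t N : 0 <= t -> INR N <= t -> dnorm N t <= 2 * sqrt t.
Proof.
move=> t0 h; apply: (Rle_trans _ _ _ (dnorm_le_trivial _ _)).
by apply: Rmult_le_compat_l; [lra|apply: sqrt_le_1_alt].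
Qed.

Theorem dnorm_upper m t : 1 <= t -> dnorm m t <= sqrt (INR m.+1) / t + 36 * sqrt t.
Proof.
move=> t1; have [Nt tN] := nfloorP (Rle_trans _ _ _ Rle_0_1 t1); set N := nfloor t in Nt tN.
have st : 0 <= sqrt t := sqrt_pos t.
have s0 : 0 <= sqrt (INR m.+1) / t by apply: Rdiv_le_0_compat; [exact: sqrt_pos|lra].
case: (leqP N m) => Nm; last first.
  have h : INR m <= t by apply: Rle_trans Nt; apply: le_INR; lia.
  by have := dnorm_le_of_floor (Rle_trans _ _ _ Rle_0_1 t1) h; lra.
have [_ h] := dsum_compare t1 Nt tN Nm.
have [c1 _] := Cmod_half_bounds t1.
have h2 := dnorm_le_of_floor (Rle_trans _ _ _ Rle_0_1 t1) Nt.
have := Cmod_triangle (Cminus (dsum m t) (dsum N t)) (dsum N t).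
have -> : Cplus (Cminus (dsum m t) (dsum N t)) (dsum N t) = dsum m t by ring.
rewrite !Cmod_dsum => h3.
set d := Cmod (Cminus _ _) in h h3; have d0 : 0 <= d := Cmod_ge_0 _.
have : d <= sqrt (INR m.+1) / t + 34 * sqrt t.
  apply: (Rmult_le_reg_l t); first by lra.
  have -> : t * (sqrt (INR m.+1) / t + 34 * sqrt t) = sqrt (INR m.+1) + 34 * (t * sqrt t) by field; lra.
  by apply: (Rle_trans _ _ _ _ h); apply: Rmult_le_compat_r.
lra.
Qed.

Theorem dnorm_lower m t : 1 <= t -> t <= INR m ->
  sqrt (INR m.+1) / (2 * t) - 36 * sqrt t <= dnorm m t.
Proof.
move=> t1 tm; have [Nt tN] := nfloorP (Rle_trans _ _ _ Rle_0_1 t1); set N := nfloor t in Nt tN.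
have st : 0 <= sqrt t := sqrt_pos t.
have Nm : (N <= m)%N by apply/leP; apply: INR_le; lra.
have [h _] := dsum_compare t1 Nt tN Nm.
have [_ c1] := Cmod_half_bounds t1.
have h2 := dnorm_le_of_floor (Rle_trans _ _ _ Rle_0_1 t1) Nt.
have := Cmod_triangle (dsum m t) (Copp (dsum N t)).
rewrite -/(Cminus _ _) Cmod_opp !Cmod_dsum => h3.
set d := Cmod (Cminus _ _) in h h3; have d0 : 0 <= d := Cmod_ge_0 _.
have : sqrt (INR m.+1) / (2 * t) - 34 * sqrt t <= d.
  apply: (Rmult_le_reg_l (2 * t)); first by lra.
  have -> : 2 * t * (sqrt (INR m.+1) / (2 * t) - 34 * sqrt t) = sqrt (INR m.+1) - 68 * (t * sqrt t) by field; lra.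
  have := Rmult_le_compat_r _ _ _ d0 c1; nra.
lra.
Qed.

Lemma sum_dnorm_le m H :
  \sum_(t < H.+2) dnorm m (INR t) <=
  sqrt (INR m.+1) * (3 + ln (INR H.+1)) + 36 * (INR H.+1 * sqrt (INR H.+1)).
Proof.
have s0 : 0 <= sqrt (INR m.+1) := sqrt_pos _.
elim: H => [|H IH].
  rewrite !big_ord_recr big_ord0 [nat_of_ord _]/= [nat_of_ord _]/=.
  have h0 := dnorm_le_trivial m 0; have h1 := dnorm_upper m (Rle_refl 1).
  have : sqrt (INR m) <= sqrt (INR m.+1) by apply: sqrt_le_1_alt; apply: le_INR; lia.
  by move: h0 h1; rewrite -/(INR m.+1) /= ln_1 sqrt_1 -/(INR m.+1); lra.
rewrite (sumR_recr _ (fun t => dnorm m (INR t))).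
have H1 := INR_S_ge1 H; have H2 := INR_S_ge1 H.+1.
have ub := dnorm_upper m H2.
have e : INR H.+2 = INR H.+1 + 1 by rewrite S_INR.
have [l1 _] := ln_succ_bound H1; rewrite -e in l1.
have l2 := Rmult_le_compat_l _ _ _ s0 l1.
have mono : sqrt (INR H.+1) <= sqrt (INR H.+2) by apply: sqrt_le_1_alt; lra.
have l3 : INR H.+1 * sqrt (INR H.+1) <= INR H.+1 * sqrt (INR H.+2).
  by apply: Rmult_le_compat_l; lra.
rewrite /Rdiv in ub; move: IH ub; rewrite e -/(INR H.+1) => IH ub.
move: l2 l3 mono; rewrite e => l2 l3 mono.
lra.
Qed.


(** * Elementary symmetric sums *)

Section ESym.
Variables (T : finType) (v : T -> R) (B : {set T}).

Definition esym (j : nat) : R :=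
  \sum_(A : {set T} | (A \subset B) && (#|A| == j)) \prod_(p in A) v p.

Lemma esym0 : esym 0 = 1.
Proof.
rewrite /esym (big_pred1 set0) ?big_set0 // => A.
by rewrite cards_eq0 /=; case: eqP => [->|_]; rewrite ?sub0set ?andbF.
Qed.

Variable vmax : R.
Hypothesis v_bound : forall p, p \in B -> 0 <= v p <= vmax.

Lemma esym_ge0 j : 0 <= esym j.
Proof.
apply: sumR_ge0 => A /andP[/subsetP AB _]; apply: prodR_ge0 => p pA.
by have := v_bound (AB _ pA); lra.
Qed.

(** Double counting of the pairs (A, p) with p in A: remove p from A. *)
Lemma esym_succ_mul j : INR j.+1 * esym j.+1 =
  \sum_(A : {set T} | (A \subset B) && (#|A| == j))
     (\prod_(p in A) v p) * \sum_(p in B | p \notin A) v p.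
Proof.
have -> : INR j.+1 * esym j.+1 =
  \sum_(A : {set T} | (A \subset B) && (#|A| == j.+1)) \sum_(p in A) \prod_(q in A) v q.
  rewrite /esym sumR_distrr; apply: eq_bigr => A /andP[_ /eqP cA].
  by rewrite sumR_const -cA.
rewrite (exchange_big_dep xpredT) //=.
transitivity (\sum_p \sum_(A : {set T} | ((A \subset B) && (#|A| == j)) && ((p \in B) && (p \notin A)))
    (\prod_(q in A) v q) * v p); last first.
  rewrite (exchange_big_dep (fun A : {set T} => (A \subset B) && (#|A| == j))) //=; last first.
    by move=> p A _ /andP[].
  apply: eq_bigr => A hA; rewrite sumR_distrr; apply: eq_bigl => p.
  by rewrite hA.
apply: eq_bigr => p _.
rewrite (reindex_onto (fun A : {set T} => p |: A) (fun A => A :\ p)) /=; last first.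
  by move=> A /andP[_ pA]; rewrite setD1K.
apply: eq_big => [A|A].
  rewrite setU11 andbT subUset sub1set; case: (boolP (p \in A)) => pA.
    have -> : (p |: A) :\ p == A = false.
      by apply/eqP => e; move: pA; rewrite -e !inE eqxx.
    by rewrite !andbF.
  by rewrite setU1K // eqxx andbT cardsU1 pA add1n eqSS andbT andbC -andbA andbC -!andbA andbCA;
     case: (A \subset B); case: (p \in B); case: (#|A| == j).
move=> /andP[_ /eqP e]; have pA : p \notin A by rewrite -e !inE eqxx.
by rewrite big_setU1 //= Rmult_comm.
Qed.

(** The elements of A are missing from the inner sum, at a cost of at most vmax
    each. *)
Lemma esym_step j :
  esym j * (\sum_(p in B) v p - INR j * vmax) <= INR j.+1 * esym j.+1.
Proof.
rewrite esym_succ_mul /esym sumR_distrl; apply: sumR_le => A /andP[AB /eqP cA].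
apply: Rmult_le_compat_l.
  by apply: prodR_ge0 => p pA; have := v_bound (subsetP AB _ pA); lra.
have -> : \sum_(p in B) v p = \sum_(p in A) v p + \sum_(p in B | p \notin A) v p.
  rewrite (bigID (fun p => p \in A)) /=; congr (_ + _); apply: eq_bigl => p.
  by case: (boolP (p \in A)) => pA; rewrite ?andbF ?andbT // (subsetP AB).
have : \sum_(p in A) v p <= INR j * vmax.
  rewrite -cA -sumR_const; apply: sumR_le => p pA.
  by have := v_bound (subsetP AB _ pA); lra.
lra.
Qed.

Lemma esym_ratio J i s : (i <= J)%N -> 0 < s -> s <= \sum_(p in B) v p - INR J * vmax ->
  0 <= vmax ->
  (s / INR J) ^ i * esym (J - i) <= esym J.
Proof.
move=> iJ s0 hs vm; elim: i iJ => [|i IH] iJ.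
  by rewrite subn0 /=; lra.
apply: Rle_trans (IH (ltnW iJ)).
rewrite /= Rmult_comm -Rmult_assoc Rmult_comm; apply: Rmult_le_compat_l.
  apply: pow_le; apply: Rdiv_le_0_compat; first by lra.
  by apply: lt_0_INR; lia.
have J0 : 0 < INR J by apply: lt_0_INR; lia.
set j := (J - i.+1)%N; have -> : (J - i)%N = j.+1 by rewrite /j; lia.
have jJ : INR j.+1 <= INR J by apply: le_INR; lia.
have jJ' : INR j <= INR J by apply: le_INR; lia.
have h := esym_step j; have e1 := esym_ge0 j; have e2 := esym_ge0 j.+1.
have h1 : esym j * s <= INR J * esym j.+1.
  have := Rmult_le_compat_r _ _ _ vm jJ' => h2.
  have h3 : esym j * s <= esym j * (\sum_(p in B) v p - INR j * vmax).
    by apply: Rmult_le_compat_l => //; lra.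
  have := Rmult_le_compat_r _ _ _ e2 jJ; lra.
apply: (Rmult_le_reg_l (INR J)) => //.
by have -> : INR J * (esym j * (s / INR J)) = esym j * s by field; lra.
Qed.

Lemma esym_gt0 J s : 0 < s -> s <= \sum_(p in B) v p - INR J * vmax ->
  0 <= vmax -> 0 < esym J.
Proof.
move=> s0 hs vm; case: J hs => [|J] hs; first by rewrite esym0; lra.
apply: (Rlt_le_trans _ _ _ _ (esym_ratio (leqnn _) s0 hs vm)).
rewrite subnn esym0 Rmult_1_r; apply: pow_lt; apply: Rdiv_lt_0_compat => //.
exact: INR_S_gt0.
Qed.
End ESym.

(** * Resonators built from blocks of primes *)

Lemma sum_family_prod (n : nat) (T : finType) (Q : 'I_n -> pred {set T})
    (F : 'I_n -> {set T} -> R) :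
  \sum_(A : {ffun 'I_n -> {set T}} | A \in finfun.family Q) \prod_k F k (A k) =
  \prod_k \sum_(A : {set T} | Q k A) F k A.
Proof. by rewrite (@bigA_distr_big_dep R 0 1 Rmult Rplus). Qed.

Lemma card_family_R (n : nat) (T : finType) (Q : 'I_n -> pred {set T}) :
  INR #|finfun.family Q| = \prod_k INR #|Q k|.
Proof.
transitivity (\sum_(A : {ffun 'I_n -> {set T}} | A \in finfun.family Q)
    \big[Rmult/1]_(k : 'I_n) 1).
  by rewrite big1_eq sumR_const Rmult_1_r.
rewrite (@sum_family_prod n T Q (fun _ _ => 1)).
by apply: eq_bigr => k _; rewrite sumR_const Rmult_1_r.
Qed.

Lemma INR_prodn (T : finType) (P : pred T) (F : T -> nat) :
  INR (\prod_(i | P i) F i)%N = \prod_(i | P i) INR (F i).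
Proof.
apply: (big_morph INR) => [x y|]; [exact: mult_INR|by []].
Qed.

Lemma prodR_inv (T : finType) (P : pred T) (F : T -> R) :
  / (\prod_(i | P i) F i) = \prod_(i | P i) / F i.
Proof.
apply: (big_morph Rinv) => [x y|]; [exact: Rinv_mult|exact: Rinv_1].
Qed.

(** An element A of the type fam stands for the integer [pnum A], the product of all
    primes in all the A k.  Families indexed by the blocks, instead of plain sets of
    primes, turn every sum over a layer into a product over the blocks. *)
Section GalResonance.
Variables (X n : nat) (B : 'I_n -> {set 'I_X}).
Local Notation T := 'I_X.
Local Notation fam := {ffun 'I_n -> {set T}}.
Hypothesis B_prime : forall k (p : T), p \in B k -> prime p.
Hypothesis B_disj : forall k k' (p : T), p \in B k -> p \in B k' -> k = k'.

Definition layer (j : 'I_n -> nat) (k : 'I_n) : pred {set T} :=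
  [pred A : {set T} | (A \subset B k) && (#|A| == j k)].
Definition layers j : {pred fam} := finfun.family (layer j).
Definition pnum (A : fam) : nat := (\prod_k \prod_(p in A k) p)%N.

Lemma layersP j (A : fam) :
  reflect (forall k, A k \subset B k /\ #|A k| = j k) (A \in layers j).
Proof.
apply: (iffP familyP) => h k; first by have := h k; rewrite inE => /andP[? /eqP].
by rewrite inE; have [-> ->] := h k; rewrite eqxx.
Qed.

Lemma pnum_gt0 j A : A \in layers j -> (0 < pnum A)%N.
Proof.
move=> /layersP h; apply: prodn_gt0 => k; apply: prodn_cond_gt0 => p pA.
by apply: prime_gt0; apply: (B_prime (k := k)); apply: (subsetP (h k).1).
Qed.

(** Unique factorisation: p in the k-th block belongs to A k if and only if it
    divides [pnum A]. *)
Lemma pnum_inj j : {in layers j &, injective pnum}.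
Proof.
suff main A k p : A \in layers j -> p \in B k -> (p \in A k) = (p %| pnum A)%N.
  move=> A A' hA hA' e; apply/ffunP => k; apply/setP => p.
  case: (boolP (p \in B k)) => pB; first by rewrite !main // e.
  have out C : C \in layers j -> p \in C k = false.
    move=> /layersP /(_ k)[CB _]; apply/negbTE; apply: contra pB; exact: subsetP.
  by rewrite !out.
move=> /layersP hA pB; have pp := B_prime pB; apply/idP/idP => [pA|].
  by rewrite /pnum (bigD1 k) //= (bigD1 p) //= -mulnA dvdn_mulr.
rewrite /pnum Euclid_dvd_prod // big_orE => /existsP[k' /=].
rewrite Euclid_dvd_prod // big_orE => /existsP[q /andP[qA]].
have qB : q \in B k' by apply: (subsetP (hA k').1).
rewrite dvdn_prime2 //; last exact: B_prime qB.
by move=> /eqP /val_inj pq; rewrite pq in pB *; rewrite (B_disj pB qB).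
Qed.

Definition pweight (A : fam) : R := / sqrt (INR (pnum A)).

Lemma pweight_sqr j A : A \in layers j ->
  pweight A ^ 2 = \prod_k \prod_(p in A k) / INR p.
Proof.
move=> hA; have p0 : 0 < INR (pnum A) by apply: lt_0_INR; have := pnum_gt0 hA; lia.
rewrite /pweight pow_inv pow2_sqrt; last by lra.
rewrite /pnum INR_prodn prodR_inv; apply: eq_bigr => k _.
by rewrite INR_prodn prodR_inv.
Qed.

Definition layer_mass j := \prod_k esym (fun p : T => / INR p) (B k) (j k).

Lemma sum_pweight_sqr j : \sum_(A | A \in layers j) pweight A ^ 2 = layer_mass j.
Proof.
rewrite (eq_bigr _ (fun A => @pweight_sqr j A)).
exact: (@sum_family_prod n T (layer j) (fun k A => \prod_(p in A) / INR p)).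
Qed.

Definition layer_count j := \prod_k INR 'C(#|B k|, j k).

Lemma card_layers j : INR #|layers j| = layer_count j.
Proof.
rewrite card_family_R; apply: eq_bigr => k _; congr INR.
by rewrite -cards_draws cardsE.
Qed.

Lemma sum_layers_pweight j : \sum_(A | A \in layers j) pweight A <=
  sqrt (layer_count j) * sqrt (layer_mass j).
Proof.
have := cauchy_schwarz_sqrt (fun A => A \in layers j) (fun _ => 1) pweight.
rewrite sum_pweight_sqr.
rewrite (eq_bigr pweight) => [|A _]; last by rewrite Rmult_1_l.
by rewrite pow1 sumR_const Rmult_1_r -card_layers.
Qed.

Variables (J i : 'I_n -> nat) (L H m : nat) (mx : R).
Hypothesis L_gt0 : (0 < L)%N.
Hypothesis pnum_le : forall I, I \in layers i -> (pnum I <= m.+1)%N.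
Hypothesis mx_ge0 : 0 <= mx.
Hypothesis mx_max : forall t : nat, (H <= t < L)%N -> dnorm m.+1 (INR t) <= mx.
Let Ji k := (J k - i k)%N.
Hypothesis mass_gt0 : 0 < layer_mass J.
Hypothesis mass_gt0' : 0 < layer_mass Ji.

(** The number of divisors of the integer of b that have type i does not depend
    on b. *)
Lemma card_sub_layers b : b \in layers J ->
  INR #|[pred I in layers i | [forall k, I k \subset b k]]| = \prod_k INR 'C(J k, i k).
Proof.
move=> /layersP hb.
have -> : #|[pred I in layers i | [forall k, I k \subset b k]]| =
  #|finfun.family (fun k => [pred A : {set T} | (A \subset b k) && (#|A| == i k)])|.
  apply: eq_card => I; rewrite inE; apply/andP/familyP.
    by move=> [/layersP h /forallP h'] k; rewrite inE h' (h k).2 eqxx.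
  move=> h; split.
    apply/layersP => k; have := h k; rewrite inE => /andP[h1 /eqP ->]; split=> //.
    by apply: subset_trans h1 _; case: (hb k).
  by apply/forallP => k; have := h k; rewrite inE => /andP[].
rewrite card_family_R; apply: eq_bigr => k _; congr INR.
by rewrite -(hb k).2 -cards_draws cardsE.
Qed.

Lemma pnum_setD (I b : fam) : I \in layers i -> [forall k, I k \subset b k] ->
  pnum b = (pnum [ffun k => b k :\: I k] * pnum I)%N.
Proof.
move=> _ /forallP Ib; rewrite /pnum -big_split /=; apply: eq_bigr => k _.
rewrite ffunE (big_setID (I k)) /= mulnC; congr (_ * _)%N.
by rewrite (setIidPr (Ib k)).
Qed.

Lemma layers_setD (I b : fam) : I \in layers i -> b \in layers J -> [forall k, I k \subset b k] ->
  [ffun k => b k :\: I k] \in layers Ji.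
Proof.
move=> /layersP hI /layersP hb /forallP Ib; apply/layersP => k; rewrite ffunE; split.
  by apply: subset_trans (subsetDl _ _) _; case: (hb k).
by rewrite cardsD (setIidPr (Ib k)) (hb k).2 (hI k).2.
Qed.

(** With weights m^(-1/2) the product n^(-1/2) f(m) g(nm) depends only on b = nm, so
    the gain is the mass of layer J times its number of divisors of type i. *)
Theorem gal_resonance :
  (\prod_k INR 'C(J k, i k)) * sqrt (layer_mass J / layer_mass Ji) / 4 <=
  36 * mx + 2 / INR L * sqrt (layer_count Ji) * sqrt (layer_count J) *
    \sum_(t < H) dnorm m.+1 (INR t).
Proof.
set GJ := layer_mass J; set GI := layer_mass Ji.
have sJ : 0 < sqrt GJ by apply: sqrt_lt_R0.
have sI : 0 < sqrt GI by apply: sqrt_lt_R0.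
pose f (A : fam) := if A \in layers Ji then pweight A / sqrt GI else 0.
pose g (A : fam) := if A \in layers J then pweight A / sqrt GJ else 0.
pose C (I : fam) : pred fam := [pred b | (b \in layers J) && [forall k, I k \subset b k]].
pose h (I b : fam) : fam := [ffun k => b k :\: I k].
pose iota (I : fam) : 'I_m.+1 := inord (pnum I).-1.
have iotaE I : I \in layers i -> (iota I).+1 = pnum I.
  move=> hI; rewrite /iota inordK; first by rewrite prednK // (pnum_gt0 hI).
  by have := pnum_le hI; have := pnum_gt0 hI; lia.
have pos j A : A \in layers j -> 0 < INR (pnum A).
  by move=> hA; apply: lt_0_INR; have := pnum_gt0 hA; lia.
have w0 A : 0 <= pweight A.
  rewrite /pweight; case: (Req_dec (sqrt (INR (pnum A))) 0) => [->|h0].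
    by rewrite Rinv_0; lra.
  by left; apply: Rinv_0_lt_compat; have := sqrt_pos (INR (pnum A)); lra.
have norm j G : layer_mass j = G -> 0 < sqrt G ->
  \sum_(A : fam) (if A \in layers j then pweight A / sqrt G else 0) ^ 2 = 1.
  move=> e G0; rewrite (eq_bigr (fun A => if A \in layers j then pweight A ^ 2 * / G else 0)).
    rewrite -big_mkcond /= -sumR_distrl sum_pweight_sqr e.
    by apply: Rinv_r => e0; move: G0; rewrite e0 sqrt_0; lra.
  move=> A _; case: ifP => _; last by rewrite /=; ring.
  rewrite Rpow_mult_distr pow_inv pow2_sqrt //.
  by left; apply: sqrt_lt_0_alt; rewrite sqrt_0.
have total j G : layer_mass j = G -> 0 < sqrt G ->
  \sum_(A : fam) (if A \in layers j then pweight A / sqrt G else 0) <= sqrt (layer_count j).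
  move=> e G0; rewrite -big_mkcond /= -sumR_distrl.
  apply: (Rmult_le_reg_r (sqrt G)) => //; rewrite Rmult_assoc Rinv_l; last by lra.
  by rewrite Rmult_1_r -e; exact: sum_layers_pweight.
have fg0 (q : R) (A : fam) (D : {pred fam}) : 0 < q -> 0 <= (if A \in D then pweight A / q else 0).
  by move=> q0; case: ifP => _; [apply: Rdiv_le_0_compat|lra].
have dw (s : 'I_m.+1) : 0 <= dweight s.
  by left; apply: Rinv_0_lt_compat; apply: sqrt_lt_R0; exact: INR_S_gt0.
have ii : {in layers i &, injective iota}.
  move=> I I' hI hI' e; apply: (pnum_inj hI hI').
  by rewrite -iotaE // -iotaE // e.
have hi I : I \in layers i -> {in C I &, injective (h I)}.
  move=> _ b b'; rewrite !inE => /andP[_ /forallP s] /andP[_ /forallP s'] e.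
  apply/ffunP => k; have := congr1 (fun F : fam => F k) e; rewrite !ffunE => ek.
  by rewrite -(setID (b k) (I k)) -(setID (b' k) (I k)) ek (setIidPr (s k)) (setIidPr (s' k)).
have fr I b : I \in layers i -> C I b ->
   ln (INR (pnum (h I b))) + dfreq (iota I) = ln (INR (pnum b)).
  move=> hI /andP[hb Ib]; rewrite /dfreq iotaE //.
  rewrite (pnum_setD hI Ib) mult_INR ln_mult //; last exact: pos hI.
  exact: pos (layers_setD hI hb Ib).
have res := @resonance _ _ _ _ (@dweight m.+1) (@dfreq m.+1)
  (fun I => I \in layers i) iota f (fun A => ln (INR (pnum A))) g (fun A => ln (INR (pnum A)))
  C h L H mx L_gt0 dw (fun A => fg0 _ A _ sI) (fun A => fg0 _ A _ sJ)
  (norm _ _ erefl sI) (norm _ _ erefl sJ) ii hi fr mx_ge0 mx_max.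
apply: Rle_trans (Rle_trans _ _ _ res _).
  apply: Rmult_le_compat_r; first by lra.
  apply: Req_le.
  transitivity (\sum_(b | b \in layers J) \sum_(I in [pred I in layers i | [forall k, I k \subset b k]])
     pweight b ^ 2 * / (sqrt GI * sqrt GJ)).
    transitivity (\sum_(b | b \in layers J) (\prod_k INR 'C(J k, i k)) * (pweight b ^ 2 * / (sqrt GI * sqrt GJ))).
      rewrite -sumR_distrr -sumR_distrl sum_pweight_sqr -/GJ; congr (_ * _).
      rewrite sqrt_div; [|exact: Rlt_le|exact: mass_gt0'].
      have {2}<- := sqrt_sqrt GJ (Rlt_le _ _ mass_gt0).
      by field; lra.
    by apply: eq_bigr => b hb; rewrite sumR_const card_sub_layers.
  rewrite (exchange_big_dep (fun I => I \in layers i)) /=; last first.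
    by move=> b I _; rewrite inE => /andP[].
  apply: eq_bigr => I hI; apply: eq_big => b.
    by rewrite [I \in _]unfold_in /= hI.
  rewrite [I \in _]unfold_in /= hI /= => /andP[hb Ib].
  rewrite /f /g /h (layers_setD hI hb Ib) hb /dweight iotaE // /pweight.
  rewrite (pnum_setD hI Ib) mult_INR.
  have p1 := pos _ _ hI; have p2 := pos _ _ (layers_setD hI hb Ib).
  set a := INR _ in p2 *; set c := INR (pnum I) in p1 *.
  rewrite sqrt_mult; try lra.
  have a0 : 0 < sqrt a by apply: sqrt_lt_R0.
  have c0 : 0 < sqrt c by apply: sqrt_lt_R0.
  by field; lra.
apply: Rplus_le_compat_l; apply: Rmult_le_compat_r.
  by apply: sumR_ge0 => t _; exact: dnorm_ge0.
have L0 : 0 < INR L by apply: lt_0_INR; lia.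
rewrite !Rmult_assoc; apply: Rmult_le_compat_l; first by lra.
apply: Rmult_le_compat_l; first by left; apply: Rinv_0_lt_compat.
apply: Rmult_le_compat; try by apply: sumR_ge0 => A _; apply: fg0.
  exact: total.
exact: total.
Qed.
End GalResonance.


(** * Mertens' first theorem *)

Lemma INR_expn a b : INR (expn a b) = INR a ^ b.
Proof. by elim: b => [|b IH] //; rewrite expnS mult_INR IH. Qed.

Lemma ln_prodR (T : finType) (P : pred T) (F : T -> R) : (forall i, P i -> 0 < F i) ->
  ln (\prod_(i | P i) F i) = \sum_(i | P i) ln (F i).
Proof.
move=> F0; have : 0 < \prod_(i | P i) F i /\ ln (\prod_(i | P i) F i) = \sum_(i | P i) ln (F i).
  apply: (big_ind2 (fun a b => 0 < a /\ ln a = b)) => [|a b c d [a0 <-] [c0 <-]|i Pi].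
  - by split; [lra|exact: ln_1].
  - by split; [apply: Rmult_lt_0_compat|rewrite ln_mult].
  - by split; [exact: F0|].
by case.
Qed.

(** The logarithm of the prime factorisation; X is any bound for the primes. *)
Lemma ln_natE N X : (0 < N)%N -> (N <= X)%N ->
  ln (INR N) = \sum_(p < X.+1 | prime p) INR (logn p N) * ln (INR p).
Proof.
move=> N0 NX; rewrite -[in LHS](partnT N0) (widen_partn _ NX) big_mkord INR_prodn.
rewrite ln_prodR => [|p _]; last first.
  rewrite INR_expn; case: (posnP p) => [p0|pp]; last by apply: pow_lt; apply: lt_0_INR; lia.
  by rewrite p0 lognE /=; lra.
rewrite [RHS]big_mkcond; apply: eq_bigr => p _; rewrite INR_expn.
case: (boolP (prime p)) => pp.
  by rewrite ln_pow //; apply: lt_0_INR; have := prime_gt0 pp; lia.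
by rewrite lognE (negbTE pp) /= ln_1.
Qed.

Definition theta (n : nat) : R := \sum_(p < n.+1 | prime p) ln (INR p).

Lemma ln_prime_ge0 (p : nat) : prime p -> 0 <= ln (INR p).
Proof.
move=> pp; rewrite -ln_1; apply: ln_le; first lra.
by rewrite -[1]/(INR 1); apply: le_INR; have := prime_gt0 pp; lia.
Qed.

Lemma central_bin_le m : INR 'C(m + m, m) <= 4 ^ m.
Proof.
have -> : 4 ^ m = INR (expn 2 (m + m)).
  by rewrite INR_expn pow_add -Rpow_mult_distr; congr (_ ^ _); rewrite /=; lra.
apply: le_INR; apply/leP.
rewrite (expnDn 1 1) (bigD1 (inord m : 'I_(m + m).+1)) //= inordK; last by lia.
by rewrite !exp1n !muln1 leq_addr.
Qed.

Lemma sum_prime_split (F : nat -> R) a b : (a <= b)%N ->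
  \sum_(p < b.+1 | prime p) F p =
  \sum_(p < a.+1 | prime p) F p + \sum_(p < b.+1 | prime p && (a < p)%N) F p.
Proof.
move=> ab; rewrite (bigID (fun p : 'I_b.+1 => (p <= a)%N)) /=; congr (_ + _).
  rewrite (big_ord_widen_cond b.+1 (fun p => prime p) F); last by rewrite ltnS.
  by apply: eq_bigl => p; rewrite ltnS.
by apply: eq_bigl => p; rewrite ltnNge.
Qed.

Lemma prime_ndvd_fact p m : prime p -> (m < p)%N -> ~~ (p %| m`!)%N.
Proof.
move=> pp; elim: m => [|m IH] mp; first by rewrite fact0 dvdn1; case: eqP pp => // ->.
by rewrite factS Euclid_dvdM // negb_or IH ?(ltnW mp) // andbT gtnNdvd.
Qed.

(** Every prime p with m < p <= 2m divides binomial(2m, m), which is at most 4^m. *)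
Lemma theta_double m : theta (m + m) <= theta m + INR m * 2.
Proof.
rewrite /theta (@sum_prime_split (fun p => ln (INR p)) m) ?leq_addr //.
apply: Rplus_le_compat_l.
have C0 : (0 < 'C(m + m, m))%N by rewrite bin_gt0 leq_addr.
apply: (Rle_trans _ (ln (INR 'C(m + m, m)))); last first.
  have h := @central_bin_le m.
  apply: (Rle_trans _ (ln (4 ^ m))); first by apply: ln_le => //; apply: lt_0_INR; lia.
  rewrite ln_pow; last by lra.
  apply: Rmult_le_compat_l; first exact: pos_INR.
  have -> : 4 = 2 ^ 2 by lra.
  rewrite ln_pow; last by lra.
  have : ln 2 <= 1; last by rewrite /=; lra.
  have := exp_ineq1_le 1 => h1; rewrite -(ln_exp 1); apply: ln_le; lra.
set X := maxn (m + m) 'C(m + m, m).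
rewrite (@ln_natE _ X) //; last exact: leq_maxr.
have -> : \sum_(p < (m + m).+1 | prime p && (m < p)%N) ln (INR p) =
  \sum_(p < X.+1 | (prime p && (m < p)%N) && (p < (m + m).+1)%N) ln (INR p).
  by rewrite (big_ord_widen_cond X.+1 (fun p => prime p && (m < p)%N) (fun p => ln (INR p))) // ltnS leq_maxl.
apply: (Rle_trans _ (\sum_(p < X.+1 | (prime p && (m < p)%N) && (p < (m + m).+1)%N)
     INR (logn p 'C(m + m, m)) * ln (INR p))).
  apply: sumR_le => p /andP[/andP[pp mp] pm].
  rewrite -{1}[ln _]Rmult_1_l; apply: Rmult_le_compat_r; first exact: ln_prime_ge0.
  rewrite -[1]/(INR 1); apply: le_INR; apply/leP.
  rewrite logn_gt0 mem_primes pp C0 /=.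
  have : (p %| 'C(m + m, m) * (m`! * (m + m - m)`!))%N.
    by rewrite bin_fact ?leq_addr // dvdn_fact // prime_gt0.
  by rewrite addnK !Euclid_dvdM // !(negbTE (prime_ndvd_fact pp mp)) !orbF.
apply: sumR_le_cond => [p /andP[/andP[]]//|p pp].
by apply: Rmult_le_pos; [exact: pos_INR|exact: ln_prime_ge0].
Qed.

(** Chebyshev's bound, by repeated halving of n. *)
Lemma theta_le n : theta n <= 4 * INR n.
Proof.
elim/ltn_ind: n => n IH.
case: (posnP n) => [->|n0].
  by rewrite /theta big_pred0 ?Rmult_0_r; [lra|case=> -[|[]]].
case: n n0 IH => // n _ IH; case: (posnP n) => [->|n0].
  by rewrite /theta big_pred0 /=; [lra|case=> -[|[]]].
set m := n.+1./2; have h := theta_double m.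
have hm := IH m ltac:(rewrite /m; lia).
case: (boolP (odd n.+1)) => od; last first.
  have <- : (m + m = n.+1)%N by rewrite /m; lia.
  by rewrite plus_INR; have := pos_INR m; lra.
have e : (m + m = n)%N by rewrite /m; lia.
have e2 : INR n = INR m + INR m by rewrite -e plus_INR.
have : theta n.+1 <= theta n + ln (INR n.+1).
  rewrite /theta big_mkcond [X in _ <= X + _]big_mkcond.
  rewrite (sumR_recr _ (fun p => if prime p then ln (INR p) else 0)).
  apply: Rplus_le_compat_l; case: ifP => _; first exact: Rle_refl.
  by rewrite -ln_1; apply: ln_le; [lra|exact: INR_S_ge1].
have := ln_le_pred (INR_S_gt0 n); rewrite S_INR e2 -e; have := pos_INR m; lra.
Qed.

Lemma ln_fact_lower n : INR n * ln (INR n) - INR n <= ln (INR n`!).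
Proof.
case: n => [|n]; first by rewrite /= ln_1; lra.
elim: n => [|n IH]; first by rewrite /= ln_1; lra.
rewrite factS mult_INR ln_mult; [|exact: INR_S_gt0|by apply: lt_0_INR; have := fact_gt0 n.+1; lia].
have r1 := INR_S_ge1 n; have [_ h] := ln_succ_bound r1.
have e : INR n.+2 = INR n.+1 + 1 by rewrite S_INR.
have : INR n.+1 * (ln (INR n.+1 + 1) - ln (INR n.+1)) <= 1.
  by apply: (Rle_trans _ (INR n.+1 * / INR n.+1)); [apply: Rmult_le_compat_l; lra|rewrite Rinv_r; lra].
by rewrite e; lra.
Qed.

Lemma ln_fact_upper n : ln (INR n`!) <= INR n * ln (INR n).
Proof.
case: n => [|n]; first by rewrite /= ln_1; lra.
elim: n => [|n IH]; first by rewrite /= ln_1; lra.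
rewrite factS mult_INR ln_mult; [|exact: INR_S_gt0|by apply: lt_0_INR; have := fact_gt0 n.+1; lia].
have l : ln (INR n.+1) <= ln (INR n.+2) by apply: ln_le; [exact: INR_S_gt0|apply: le_INR; lia].
have := Rmult_le_compat_l _ _ _ (pos_INR n.+1) l.
by rewrite (S_INR n.+1); lra.
Qed.

Lemma logn_gt_fact p n : (n < p)%N -> logn p n`! = 0%N.
Proof.
move=> np; case: (boolP (prime p)) => pp; last by rewrite lognE (negbTE pp).
by rewrite lognE pp (negbTE (prime_ndvd_fact pp np)) !andbF.
Qed.

Lemma ln_fact_primes n :
  ln (INR n`!) = \sum_(p < n.+1 | prime p) INR (logn p n`!) * ln (INR p).
Proof.
have nf : (n <= n`!)%N.
  by case: n => // n; rewrite factS leq_pmulr ?fact_gt0.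
rewrite (@ln_natE _ (n`!)) ?fact_gt0 //.
rewrite (@sum_prime_split (fun p => INR (logn p n`!) * ln (INR p)) n) //.
rewrite [X in _ + X]big1 ?Rplus_0_r // => p /andP[_ np].
by rewrite logn_gt_fact //= Rmult_0_l.
Qed.

Lemma INR_divn_le a b : INR (a %/ b) <= INR a / INR b.
Proof.
case: b => [|b]; first by rewrite divn0 /= /Rdiv Rinv_0; lra.
have b0 := INR_S_gt0 b.
apply: (Rmult_le_reg_r (INR b.+1)) => //.
have -> : INR a / INR b.+1 * INR b.+1 = INR a by field; lra.
by rewrite -mult_INR; apply: le_INR; apply/leP; exact: leq_divM.
Qed.

(** Legendre's formula is dominated by a geometric series. *)
Lemma logn_fact_le p n : prime p -> INR (logn p n`!) <= INR n / (INR p - 1).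
Proof.
move=> pp; have p2 : 2 <= INR p by rewrite -[2]/(INR 2); apply: le_INR; have := prime_gt1 pp; lia.
have n0 := pos_INR n.
rewrite logn_fact // big_add1 /= big_mkord.
have -> : INR (\sum_(k < n) n %/ expn p k.+1)%N = \sum_(k < n) INR (n %/ expn p k.+1).
  by apply: (big_morph INR) => //; exact: plus_INR.
apply: (Rle_trans _ (\sum_(k < n) INR n * (/ INR p) ^ k.+1)).
  apply: sumR_le => k _; apply: (Rle_trans _ _ _ (INR_divn_le _ _)).
  by rewrite INR_expn pow_inv; exact: Rle_refl.
have geom N : \sum_(k < N) INR n * (/ INR p) ^ k.+1 = INR n / (INR p - 1) * (1 - (/ INR p) ^ N).
  elim: N => [|N IH]; first by rewrite big_ord0 /=; ring.
  rewrite (sumR_recr _ (fun k => INR n * (/ INR p) ^ k.+1)) IH /=; field; lra.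
rewrite geom; have h : 0 <= (/ INR p) ^ n by apply: pow_le; left; apply: Rinv_0_lt_compat; lra.
have q0 : 0 <= INR n / (INR p - 1) by apply: Rdiv_le_0_compat; lra.
by have := Rmult_le_pos _ _ q0 h; lra.
Qed.

Lemma logn_fact_ge p n : prime p -> INR n / INR p - 1 <= INR (logn p n`!).
Proof.
move=> pp; have p2 : 2 <= INR p by rewrite -[2]/(INR 2); apply: le_INR; have := prime_gt1 pp; lia.
case: n => [|n]; first by have := pos_INR (logn p 0`!); rewrite [INR 0]/= /Rdiv Rmult_0_l; lra.
apply: (Rle_trans _ (INR (n.+1 %/ p))); last first.
  by apply: le_INR; apply/leP; rewrite logn_fact // big_add1 /= big_mkord big_ord_recl expn1 leq_addr.
have : INR n.+1 <= INR (n.+1 %/ p) * INR p + INR p.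
  rewrite -mult_INR -plus_INR; apply: le_INR; apply/leP.
  rewrite {1}(divn_eq n.+1 p) leq_add2l ltnW // ltn_mod; exact: prime_gt0.
move=> h; apply: (Rmult_le_reg_r (INR p)); first by lra.
have -> : (INR n.+1 / INR p - 1) * INR p = INR n.+1 - INR p by field; lra.
lra.
Qed.

Definition mertens (n : nat) : R := \sum_(p < n.+1 | prime p) ln (INR p) / INR p.

(** Both bounds compare log n! = n log n + O(n) with its factorisation, in which p
    has an exponent between n/p - 1 and n/(p-1); the -1 costs [theta n]. *)
Lemma mertens_upper n : (0 < n)%N -> mertens n <= ln (INR n) + 4.
Proof.
move=> n0; have n0' : 0 < INR n by apply: lt_0_INR; lia.
apply: (Rmult_le_reg_l (INR n)) => //.
have h1 := ln_fact_upper n; have h2 := theta_le n.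
have : INR n * mertens n - theta n <= ln (INR n`!); last by lra.
rewrite ln_fact_primes /mertens /theta sumR_distrr -sumR_sub; apply: sumR_le => p pp.
have := Rmult_le_compat_r _ _ _ (ln_prime_ge0 pp) (logn_fact_ge n pp).
by rewrite /Rdiv; lra.
Qed.

(** This bounds the excess of the sum of log p / (p-1) over that of log p / p; it
    follows from log p <= 2 sqrt p and a telescoping series. *)
Lemma sum_ln_over_sq n :
  \sum_(p < n.+1 | prime p) ln (INR p) / (INR p * (INR p - 1)) <= 16.
Proof.
suff h : \sum_(p < n.+1 | prime p) ln (INR p) / (INR p * (INR p - 1)) <=
   16 * (1 - / sqrt (INR n.+1)).
  have : 0 < / sqrt (INR n.+1) by apply: Rinv_0_lt_compat; apply: sqrt_lt_R0; exact: INR_S_gt0.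
  by lra.
rewrite big_mkcond; pose F (p : nat) := if prime p then ln (INR p) / (INR p * (INR p - 1)) else 0.
rewrite -[X in X <= _]/(\sum_(p < n.+1) F p); elim: n => [|n IH].
  by rewrite sumR_recr big_ord0 /F /= sqrt_1; lra.
rewrite sumR_recr.
set r := INR n.+1; have r1 : 1 <= r := INR_S_ge1 n.
have rS : INR n.+2 = r + 1 by rewrite S_INR.
have tel := inv_sqrt_telescope r1.
suff : F n.+1 <= 4 * (sqrt r / r ^ 2) by move: IH; rewrite rS -/r; lra.
have sr : 0 < sqrt r by apply: sqrt_lt_R0; lra.
have r2 : 0 < r ^ 2 by nra.
rewrite /F; case: ifP => [pp|_]; last first.
  by apply: Rmult_le_pos; [lra|apply: Rdiv_le_0_compat; lra].
have p2 : 2 <= r by rewrite -[2]/(INR 2); apply: le_INR; have := prime_gt1 pp; lia.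
have l : ln r <= 2 * sqrt r.
  have e : ln r = ln (sqrt r) + ln (sqrt r) by rewrite -ln_mult // sqrt_sqrt //; lra.
  by have := ln_le_pred sr; lra.
rewrite -/r; apply: (Rle_trans _ (2 * sqrt r / (r * (r - 1)))).
  by apply: Rmult_le_compat_r => //; left; apply: Rinv_0_lt_compat; nra.
have -> : 4 * (sqrt r / r ^ 2) = 2 * sqrt r * (2 / r ^ 2) by field; lra.
apply: Rmult_le_compat_l; first by lra.
apply: (Rmult_le_reg_r (r ^ 2 * (r * (r - 1)))); first by apply: Rmult_lt_0_compat; nra.
have -> : / (r * (r - 1)) * (r ^ 2 * (r * (r - 1))) = r ^ 2 by field; lra.
have -> : 2 / r ^ 2 * (r ^ 2 * (r * (r - 1))) = 2 * (r * (r - 1)) by field; lra.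
nra.
Qed.

Lemma mertens_lower n : (0 < n)%N -> ln (INR n) - 17 <= mertens n.
Proof.
move=> n0; have n0' : 0 < INR n by apply: lt_0_INR; lia.
have h1 := ln_fact_lower n; have h2 := sum_ln_over_sq n.
have : ln (INR n`!) <= INR n * (mertens n + \sum_(p < n.+1 | prime p) ln (INR p) / (INR p * (INR p - 1))).
  rewrite ln_fact_primes /mertens -sumR_add sumR_distrr; apply: sumR_le => p pp.
  have := Rmult_le_compat_r _ _ _ (ln_prime_ge0 pp) (logn_fact_le n pp).
  move=> h; apply: (Rle_trans _ _ _ h); apply: Req_le.
  have p2 : 2 <= INR p by rewrite -[2]/(INR 2); apply: le_INR; have := prime_gt1 pp; lia.
  by field; lra.
move=> h; have h3 : INR n * ln (INR n) - INR n <= INR n * (mertens n + 16).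
  by apply: (Rle_trans _ _ _ h1); apply: (Rle_trans _ _ _ h); apply: Rmult_le_compat_l; lra.
apply: (Rmult_le_reg_l (INR n)) => //; lra.
Qed.

(** The constant does not depend on A, so for large A the window has nearly the full
    mass log A. *)
Theorem mertens_window x A : (0 < x)%N -> (0 < A)%N ->
  ln (INR A) - 21 <= \sum_(p < (A * x).+1 | prime p && (x < p)%N) ln (INR p) / INR p.
Proof.
move=> x0 A0; have Ax : (0 < A * x)%N by rewrite muln_gt0 A0.
have := mertens_lower Ax; rewrite /mertens (@sum_prime_split (fun p => ln (INR p) / INR p) x); last by rewrite leq_pmull.
rewrite -/(mertens x) mult_INR ln_mult; try by apply: lt_0_INR; lia.
by have := mertens_upper x0; lra.
Qed.


(** * Estimates for one block *)

Lemma bin_term_le x N j : 0 <= x -> INR 'C(N, j) * x ^ j <= (1 + x) ^ N.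
Proof.
move=> x0; elim: N j => [|N IH] [|j]; rewrite ?bin0 ?bin0n /=; try lra.
  have := IH 0%N; rewrite bin0 /= => h; have := pow_le (1 + x) N ltac:(lra); nra.
rewrite binS plus_INR; have h1 := IH j.+1; have h2 := IH j; rewrite /= in h1.
by have := Rmult_le_compat_l _ _ _ x0 h2; lra.
Qed.

Lemma one_plus_pow_le (x : R) N : 0 <= x -> (1 + x) ^ N <= exp (INR N * x).
Proof.
move=> x0; elim: N => [|N IH]; first by rewrite Rmult_0_l exp_0 /=; lra.
have -> : INR N.+1 * x = x + INR N * x by rewrite S_INR; ring.
rewrite exp_plus /=; apply: Rmult_le_compat => //; [lra|apply: pow_le; lra|exact: exp_ineq1_le].
Qed.

(** Rankin's trick: binomial(N, j) w^j <= (1+w)^N, taken at w = J/N'. *)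
Lemma bin_le_exp N N' j J : (N <= N')%N -> (j <= J)%N -> (0 < J)%N -> (J <= N')%N ->
  INR 'C(N, j) <= exp (INR J * (1 + ln (INR N' / INR J))).
Proof.
move=> NN jJ J0 JN.
have J0' : 0 < INR J by apply: lt_0_INR; lia.
have N0' : 0 < INR N' by apply: lt_0_INR; lia.
set x := INR J / INR N'; have x0 : 0 < x by apply: Rdiv_lt_0_compat.
have x1 : x <= 1.
  apply: (Rmult_le_reg_r (INR N')) => //; rewrite /x /Rdiv Rmult_assoc Rinv_l; last by lra.
  have : INR J <= INR N' by apply: le_INR; lia.
  lra.
have h1 := @bin_term_le x N j (Rlt_le _ _ x0).
have h2 := @one_plus_pow_le x N (Rlt_le _ _ x0).
have h3 : exp (INR N * x) <= exp (INR J).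
  have : INR N * x <= INR J.
    apply: (Rle_trans _ (INR N' * x)).
      by apply: Rmult_le_compat_r; [lra|apply: le_INR; lia].
    by apply: Req_le; rewrite /x; field; lra.
  by case=> [h|->]; [left; exact: exp_increasing|right].
have h4 : x ^ J <= x ^ j.
  have -> : J = (j + (J - j))%N by lia.
  rewrite pow_add -[X in _ <= X]Rmult_1_r; apply: Rmult_le_compat_l; first by apply: pow_le; lra.
  by rewrite -(pow1 (J - j)); apply: pow_incr; lra.
have xJ : x ^ J = exp (- (INR J * ln (INR N' / INR J))).
  have -> : - (INR J * ln (INR N' / INR J)) = INR J * ln x.
    by rewrite /x !ln_div //; ring.
  by rewrite -ln_pow // exp_ln //; exact: pow_lt.
rewrite Rmult_plus_distr_l Rmult_1_r exp_plus.
apply: (Rmult_le_reg_r (x ^ J)); first exact: pow_lt.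
rewrite {2}xJ Rmult_assoc -exp_plus Rplus_opp_r exp_0 Rmult_1_r.
apply: (Rle_trans _ (INR 'C(N, j) * x ^ j)); last by lra.
by apply: Rmult_le_compat_l => //; exact: pos_INR.
Qed.

Lemma exp_le_compat a b : a <= b -> exp a <= exp b.
Proof. by case=> [h|->]; [left; exact: exp_increasing|right]. Qed.

Lemma fact_upper i : INR i`! <= INR i.+1 * (INR i ^ i * exp (1 - INR i)).
Proof.
case: i => [|i].
  by rewrite /= Rminus_0_r; have := exp_ineq1_le 1; lra.
suff h : INR i.+1`! <= INR i.+1 * (INR i.+1 ^ i.+1 * exp (1 - INR i.+1)).
  apply: (Rle_trans _ _ _ h); apply: Rmult_le_compat_r; last by apply: le_INR; lia.
  by apply: Rmult_le_pos; [apply: pow_le; exact: pos_INR|left; exact: exp_pos].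
elim: i => [|i IH]; first by rewrite /= Rminus_diag exp_0; lra.
set r := INR i.+1 in IH *; have r1 : 1 <= r := INR_S_ge1 i.
have rS : INR i.+2 = r + 1 by rewrite S_INR.
rewrite factS mult_INR rS; apply: Rmult_le_compat_l; first by lra.
apply: (Rle_trans _ _ _ IH).
have [l1 _] := ln_succ_bound r1.
have pE (a : R) : 0 < a -> forall k, a ^ k = exp (INR k * ln a).
  by move=> a0 k; rewrite -ln_pow // exp_ln //; exact: pow_lt.
rewrite !pE; try lra.
rewrite -{1}(exp_ln r); last by lra.
rewrite -!exp_plus rS -/r.
have h : (r + 1) * / (r + 1) <= (r + 1) * (ln (r + 1) - ln r) by apply: Rmult_le_compat_l; lra.
rewrite Rinv_r in h; last by lra.
by apply: exp_le_compat; lra.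
Qed.

Lemma bin_lower J i : (i <= J)%N -> INR (J - i) ^ i <= INR 'C(J, i) * INR i`!.
Proof.
move=> iJ; rewrite -mult_INR multE bin_ffact.
elim: i J iJ => [|i IH] [|J] //= iJ; try by rewrite /=; lra.
rewrite ffactSS mult_INR subSS; apply: Rmult_le_compat; [exact: pos_INR|apply: pow_le; exact: pos_INR| |exact: IH].
by apply: le_INR; lia.
Qed.

(** binomial(J,i) >= (J-i)^i / i!, so the factor is at least i^i / i!, which is
    e^i up to a polynomial in i. *)
Lemma block_gain (J i : nat) (s E E' : R) : (0 < J)%N -> (i <= J)%N -> 0 < s ->
  0 < E' -> (s / INR J) ^ i * E' <= E ->
  INR i <= INR (J - i) * sqrt (s / INR J) ->
  exp (INR i - 1 - ln (INR i.+1)) <= INR 'C(J, i) * sqrt (E / E').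
Proof.
move=> J0 iJ s0 E0 hE hi.
have J0' : 0 < INR J by apply: lt_0_INR; lia.
have q0 : 0 < s / INR J by apply: Rdiv_lt_0_compat.
have h1 : sqrt (s / INR J) ^ i <= sqrt (E / E').
  apply: sqr_le_le; first exact: sqrt_pos.
  rewrite pow2_sqrt; last first.
    apply: Rdiv_le_0_compat => //; apply: Rle_trans hE; apply: Rmult_le_pos; last by lra.
    by apply: pow_le; lra.
  rewrite -pow_mult Nat.mul_comm pow_mult pow2_sqrt; last by lra.
  apply: (Rmult_le_reg_r E') => //.
  by have -> : E / E' * E' = E by field; lra.
have f0 : 0 < INR i`! by apply: lt_0_INR; have := fact_gt0 i; lia.
have i1 := INR_S_gt0 i.
apply: (Rmult_le_reg_r (INR i`!)) => //.
apply: (Rle_trans _ (INR i ^ i)).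
  rewrite /Rminus !exp_plus !exp_Ropp exp_ln //.
  apply: (Rle_trans _ (exp (INR i) * / exp 1 * / INR i.+1 * (INR i.+1 * (INR i ^ i * exp (1 - INR i))))).
    apply: Rmult_le_compat_l; last exact: fact_upper.
    by repeat apply: Rmult_le_pos; left; try apply: Rinv_0_lt_compat; try exact: exp_pos.
  apply: Req_le; rewrite /Rminus exp_plus exp_Ropp; field.
  by repeat split; apply: Rgt_not_eq => //; exact: exp_pos.
apply: (Rle_trans _ ((INR (J - i) * sqrt (s / INR J)) ^ i)).
  by apply: pow_incr; split=> //; exact: pos_INR.
rewrite Rpow_mult_distr; have := bin_lower iJ => h2.
apply: (Rle_trans _ (INR 'C(J, i) * INR i`! * sqrt (E / E'))); last by lra.
by apply: Rmult_le_compat => //; apply: pow_le; [exact: pos_INR|exact: sqrt_pos].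
Qed.

Lemma exp_sum (T : finType) (F : T -> R) : exp (\sum_k F k) = \prod_k exp (F k).
Proof. apply: (big_morph exp) => [a b|]; [exact: exp_plus|exact: exp_0]. Qed.

Lemma sqrt_prod (T : finType) (F : T -> R) : (forall k, 0 <= F k) ->
  sqrt (\prod_k F k) = \prod_k sqrt (F k).
Proof.
move=> F0; have : 0 <= \prod_k F k /\ sqrt (\prod_k F k) = \prod_k sqrt (F k).
  apply: (big_ind2 (fun a b => 0 <= a /\ sqrt a = b)) => [|a b c d [a0 <-] [c0 <-]|i _].
  - by split; [lra|exact: sqrt_1].
  - by split; [apply: Rmult_le_pos|rewrite sqrt_mult].
  - by split.
by case.
Qed.

(** * Geometric blocks of primes *)

Section PrimeBlocks.
Variables (A Y k0 n : nat).
Hypothesis A_gt0 : (0 < A)%N.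
Hypothesis Y_gt0 : (0 < Y)%N.
(** Blocks are numbered from 0, the k-th one having exponent k0 + k. *)
Definition bot (k : nat) : nat := (expn A (k0 + k) * Y)%N.
Definition top (k : nat) : nat := (expn A (k0 + k).+1 * Y)%N.
Definition block_bound : nat := (bot n).+1.

Definition block (k : 'I_n) : {set 'I_block_bound} :=
  [set p : 'I_block_bound | prime p && (bot k < p <= top k)%N].

Lemma topE k : top k = (A * bot k)%N.
Proof. by rewrite /top /bot expnS mulnA. Qed.

Lemma bot_gt0 k : (0 < bot k)%N.
Proof. by rewrite muln_gt0 expn_gt0 A_gt0. Qed.

Lemma top_le_bot k k' : (k < k')%N -> (top k <= bot k')%N.
Proof.
move=> kk; rewrite /top /bot leq_mul2r; apply/orP; right.
by rewrite leq_pexp2l // -addnS leq_add2l.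
Qed.

Lemma block_prime k (p : 'I_block_bound) : p \in block k -> prime p.
Proof. by rewrite inE => /andP[]. Qed.

Lemma block_disjoint k k' (p : 'I_block_bound) : p \in block k -> p \in block k' -> k = k'.
Proof.
rewrite !inE => /andP[_ /andP[a b]] /andP[_ /andP[c d]]; apply: val_inj => /=.
case: (ltngtP k k') => // h; have := top_le_bot h; lia.
Qed.

Lemma block_card (k : 'I_n) : (#|block k| <= top k)%N.
Proof.
have inj : injective (fun p : 'I_block_bound => p : nat) := val_inj.
pose F (p : 'I_block_bound) : 'I_(top k).+1 := inord p.
have Fi : {in block k &, injective F}.
  move=> p q; rewrite !inE => /andP[_ /andP[_ a]] /andP[_ /andP[_ b]] /(congr1 val).
  by rewrite /F /= !inordK ?ltnS // => /val_inj.
rewrite -(card_in_imset Fi).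
have : F @: block k \subset [set~ ord0].
  apply/subsetP => q /imsetP[p]; rewrite !inE => /andP[pp /andP[_ a]] ->.
  apply/eqP => /(congr1 val); rewrite /F /= inordK ?ltnS // => p0.
  by rewrite p0 in pp.
by move=> /subset_leq_card; rewrite cardsC1 card_ord.
Qed.

(** The bound 1/p >= (log p / p) / log (top k) reduces this to [mertens_window]. *)
Lemma block_mass (k : 'I_n) : (1 < top k)%N ->
  (ln (INR A) - 21) / ln (INR (top k)) <= \sum_(p in block k) / INR p.
Proof.
move=> t1; have t1' : 1 < INR (top k) by rewrite -[1]/(INR 1); apply: lt_INR; lia.
have l0 : 0 < ln (INR (top k)) by rewrite -ln_1; apply: ln_increasing; lra.
apply: (Rmult_le_reg_r (ln (INR (top k)))) => //.
rewrite {1}/Rdiv Rmult_assoc Rinv_l ?Rmult_1_r; last by lra.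
apply: (Rle_trans _ _ _ (mertens_window (bot_gt0 k) A_gt0)).
rewrite -topE sumR_distrl.
rewrite (big_ord_widen_cond block_bound (fun p => prime p && (bot k < p)%N)
  (fun p => ln (INR p) / INR p)); last by rewrite ltnS top_le_bot.
rewrite [X in X <= _](eq_bigl (fun p => p \in block k)) => [|p]; last by rewrite inE ltnS andbA.
apply: sumR_le => p; rewrite inE => /andP[pp /andP[_ pt]].
have p0 : 0 < INR p by apply: lt_0_INR; have := prime_gt0 pp; lia.
rewrite /Rdiv Rmult_comm; apply: Rmult_le_compat_l; first by left; apply: Rinv_0_lt_compat.
by apply: ln_le => //; apply: le_INR; lia.
Qed.

Variables (J i : 'I_n -> nat) (s : 'I_n -> R) (L H m : nat) (mx : R).
Hypothesis J_gt0 : forall k, (0 < J k)%N.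
Hypothesis iJ : forall k, (i k <= J k)%N.
Hypothesis J_top : forall k, (J k <= top k)%N.
Hypothesis top_gt1 : forall k : 'I_n, (1 < top k)%N.
Hypothesis s_gt0 : forall k, 0 < s k.
Hypothesis s_le : forall k, s k <= (ln (INR A) - 21) / ln (INR (top k)) - INR (J k) / INR Y.
Hypothesis i_le : forall k, INR (i k) <= INR (J k - i k) * sqrt (s k / INR (J k)).
Hypothesis size_le : (\prod_(k : 'I_n) expn (top k) (i k) <= m.+1)%N.
Hypothesis L_gt0 : (0 < L)%N.
Hypothesis mx_ge0 : 0 <= mx.
Hypothesis mx_max : forall t : nat, (H <= t < L)%N -> dnorm m.+1 (INR t) <= mx.

(** The hypothesis [i_le] makes i at most sqrt(J s) in each block, up to the factor
    (J - i) / J, and [size_le] keeps every n in the range of the Dirichlet sum. *)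
Theorem prime_blocks_resonance :
  exp (\sum_k (INR (i k) - 1 - ln (INR (i k).+1))) / 4 <=
  36 * mx + 2 / INR L * exp (\sum_(k : 'I_n) INR (J k) * (1 + ln (INR (top k) / INR (J k)))) *
    \sum_(t < H) dnorm m.+1 (INR t).
Proof.
pose v (p : 'I_block_bound) := / INR p.
have Y0 : 0 < INR Y by apply: lt_0_INR; lia.
have vb k p : p \in block k -> 0 <= v p <= / INR Y.
  rewrite inE => /andP[_ /andP[h _]].
  have hY : INR Y <= INR p.
    by apply: le_INR; apply/leP; apply: leq_trans (ltnW h); rewrite leq_pmull // expn_gt0 A_gt0.
  by split; [left; apply: Rinv_0_lt_compat; lra|apply: Rinv_le_contravar].
have iY : 0 <= / INR Y by left; apply: Rinv_0_lt_compat.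
have sl k : s k <= \sum_(p in block k) v p - INR (J k) * / INR Y.
  by have := s_le k; have := block_mass (top_gt1 k); rewrite /v /Rdiv; lra.
have pos k j : (j <= J k)%N -> 0 < esym v (block k) j.
  move=> jJ; apply: (@esym_gt0 _ v (block k) (/ INR Y) (@vb k) j (s k)) => //.
  apply: (Rle_trans _ _ _ (sl k)).
  apply: Rplus_le_compat_l; apply: Ropp_le_contravar.
  by apply: Rmult_le_compat_r => //; apply: le_INR; lia.
have pl I : I \in layers block i -> (pnum I <= m.+1)%N.
  move=> /layersP hI; apply: leq_trans size_le; apply: leq_prod => k _.
  rewrite -(hI k).2 -prod_nat_const; apply: leq_prod => p pI.
  by have := subsetP (hI k).1 _ pI; rewrite inE => /andP[_ /andP[]].
have posJ : 0 < layer_mass block J by apply: prodR_gt0 => k _; exact: pos.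
have posI : 0 < layer_mass block (fun k => (J k - i k)%N).
  by apply: prodR_gt0 => k _; apply: pos; exact: leq_subr.
have res := gal_resonance block_prime block_disjoint L_gt0 pl mx_ge0 mx_max posJ posI.
apply: (Rle_trans _ _ _ (Rle_trans _ _ _ _ res)).
  apply: Rmult_le_compat_r; first by lra.
  have -> : layer_mass block J / layer_mass block (fun k => (J k - i k)%N) =
    \prod_k (esym v (block k) (J k) / esym v (block k) (J k - i k)).
    by rewrite /Rdiv prodR_inv -big_split.
  rewrite sqrt_prod => [|k]; last by apply: Rdiv_le_0_compat; [left|]; apply: pos => //; exact: leq_subr.
  rewrite -[X in _ <= X]big_split exp_sum; apply: prodR_le => k _; split; first by left; exact: exp_pos.
  apply: (@block_gain _ _ (s k)) => //; first by apply: pos; exact: leq_subr.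
  exact: (esym_ratio (@vb k) (iJ k) (s_gt0 k) (sl k)).
apply: Rplus_le_compat_l; apply: Rmult_le_compat_r.
  by apply: sumR_ge0 => t _; exact: dnorm_ge0.
have L0 : 0 < INR L by apply: lt_0_INR; lia.
rewrite Rmult_assoc; apply: Rmult_le_compat_l.
  by apply: Rdiv_le_0_compat; lra.
set S := exp _.
have S0 : 0 <= S by left; exact: exp_pos.
have cnt j : (forall k, (j k <= J k)%N) -> sqrt (layer_count block j) <= sqrt S.
  move=> jJ; apply: sqrt_le_1_alt; rewrite /S exp_sum; apply: prodR_le => k _.
  split; first exact: pos_INR.
  exact: bin_le_exp (block_card k) (jJ k) (J_gt0 k) (J_top k).
apply: (Rle_trans _ (sqrt S * sqrt S)); last by rewrite sqrt_sqrt //; exact: Rle_refl.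
by apply: Rmult_le_compat; try exact: sqrt_pos; apply: cnt => // k; exact: leq_subr.
Qed.
End PrimeBlocks.


(** * Choice of the parameters *)

Lemma sum_inv_upper n : \sum_(k < n) / INR (3 + k) <= ln (INR (2 + n)) - ln 2.
Proof.
elim: n => [|n IH]; first by rewrite big_ord0 addn0 (_ : INR 2 = 2); [lra|rewrite /=; lra].
rewrite (sumR_recr _ (fun k => / INR (3 + k))).
have [h _] := ln_succ_bound (INR_S_ge1 n.+1).
by move: h; rewrite -S_INR -[n.+3]/(3 + n)%N -[n.+2]/(2 + n)%N => h; rewrite addnS -[(2 + n).+1]/(3 + n)%N; lra.
Qed.

Lemma sum_inv_lower n : ln (INR (3 + n)) - ln 3 <= \sum_(k < n) / INR (3 + k).
Proof.
elim: n => [|n IH].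
  by rewrite big_ord0 addn0 (_ : INR 3 = 3); [lra|rewrite /=; lra].
rewrite (sumR_recr _ (fun k => / INR (3 + k))).
have [_ h] := ln_succ_bound (INR_S_ge1 n.+2).
by move: h; rewrite -S_INR -[n.+4]/(3 + n.+1)%N -[n.+3]/(3 + n)%N => h; lra.
Qed.

Lemma sum_inv_sqr n : \sum_(k < n) / INR (3 + k) ^ 2 <= 1 / 2.
Proof.
suff : \sum_(k < n) / INR (3 + k) ^ 2 <= 1 / 2 - / INR (2 + n).
  have : 0 < / INR (2 + n) by apply: Rinv_0_lt_compat; exact: INR_S_gt0.
  lra.
elim: n => [|n IH]; first by rewrite big_ord0 addn0 /=; lra.
rewrite (sumR_recr _ (fun k => / INR (3 + k) ^ 2)).
have e : INR (3 + n) = INR (2 + n) + 1 by rewrite -S_INR.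
have e' : INR (2 + n.+1) = INR (2 + n) + 1 by rewrite -S_INR addnS.
rewrite e ?e'; set r := INR (2 + n) in IH *.
have r1 : 1 <= r := INR_S_ge1 _.
have : / (r + 1) ^ 2 <= / r - / (r + 1).
  have -> : / r - / (r + 1) = / (r * (r + 1)) by field; lra.
  by apply: Rinv_le_contravar; nra.
lra.
Qed.

(** Positivity of an expression built from terms that [lra] knows to be positive. *)
Ltac rpos := lazymatch goal with
  | |- 0 <= _ + _ => apply: Rplus_le_le_0_compat; rpos
  | |- 0 < _ * _ => apply: Rmult_lt_0_compat; rpos
  | |- 0 <= _ * _ => apply: Rmult_le_pos; rpos
  | |- 0 < _ / _ => apply: Rdiv_lt_0_compat; rpos
  | |- 0 <= _ / _ => apply: Rdiv_le_0_compat; rpos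
  | |- 0 < _ ^ _ => apply: pow_lt; rpos
  | |- 0 <= _ ^ _ => apply: pow_le; rpos
  | |- 0 < / _ => apply: Rinv_0_lt_compat; rpos
  | |- 0 <= / _ => apply: Rlt_le; apply: Rinv_0_lt_compat; rpos
  | |- _ => lra
  end.

Lemma div_le_self a b : 0 <= a -> 1 <= b -> a / b <= a.
Proof.
move=> a0 b1; apply: (Rmult_le_reg_r b); first by lra.
have -> : a / b * b = a by field; lra.
by nra.
Qed.

Lemma sqr_mul_ge1 k z : 3 <= k -> 16 <= z -> 1 <= k ^ 2 * z.
Proof. by move=> k3 z16; nra. Qed.

(** Here d stands for a small fixed number, A for a constant with 21 / log A <= d, and
    kap k = 3 + k for the exponent of the k-th block.  The number of blocks is
    y^(1-d), so that the logarithms of all primes used are at most (1+d) y. *)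
Section Params.
Variables (d x y z : R) (A : nat).
Local Notation lam := (ln (INR A)).
Hypothesis A_gt0 : (0 < A)%N.
Hypothesis d_pos : 0 < d.
Hypothesis d_small : d <= 1 / 8.
Hypothesis lam_big : 21 <= d * lam.
Hypothesis xE : x = exp y.
Hypothesis yE : y = exp z.
Local Notation c1 := (/ (4 * lam)).
Hypothesis z_big1 : 2 <= d * z.
Hypothesis z_big2 : lam + ln (4 * (4 * lam)) + 2 * ln 2 + 2 <= z.
Hypothesis z_big3 : 4 * lam <= d * exp (d * z).
Hypothesis y_big1 : 16 * lam <= d * y.
Hypothesis y_big2 : 2 * (z + 1) <= d * y.
Hypothesis x_big1 : 4 * y ^ 3 <= c1 * d * x.
Hypothesis x_big2 : y ^ 4 <= (d / 2 * c1) ^ 2 * x.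
Hypothesis x_big3 : 9 * y ^ 5 <= d ^ 2 * x.

Let lam_ge : 168 <= lam.
Proof. by have := lam_big; have := d_small; have := d_pos; nra. Qed.
Let z_ge : 16 <= z.
Proof. by have := z_big1; have := d_small; have := d_pos; nra. Qed.
Let y_ge : z + 1 <= y.
Proof. by rewrite yE; have := exp_ineq1_le z; lra. Qed.
Let x_ge : y + 1 <= x.
Proof. by rewrite xE; have := exp_ineq1_le y; lra. Qed.
Let c1_pos : 0 < c1.
Proof. by apply: Rinv_0_lt_compat; have := lam_ge; lra. Qed.

Definition nblocks := nfloor (exp ((1 - d) * z)).
Definition base := (nfloor (x * y)).+1.
Local Notation kap k := (INR (3 + k)).
(** The factor 1/kap^2 balances the blocks: one prime of the k-th block costs about
    kap log A in the logarithm of the number of products, so that this logarithm is a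
    multiple of the harmonic sum, about x/4. *)
Definition topcount (k : nat) : nat := nfloor (c1 * x / (kap k ^ 2 * z)).
(** The optimal number of primes of n in the k-th block is sqrt(J s), which is close
    to sqrt(x / (y z)) / (2 kap). *)
Definition gain := (1 - 4 * d) / 2 * sqrt (x / (y * z)).
Definition divcount (k : nat) : nat := nfloor (gain / kap k).
(** A lower bound for the sum of 1/p over any block, after removal of the J primes
    already used. *)
Definition smass : R := (1 - 3 * d) * lam / y.

Let y1 := exp ((1 - d) * z).
Let y1E : y1 * exp (d * z) = y.
Proof. by rewrite /y1 -exp_plus yE; congr exp; ring. Qed.
Let y1_ge : 3 <= y1.
Proof.
rewrite /y1; have := exp_ineq1_le ((1 - d) * z).
by have := z_ge; have := d_small; nra.
Qed.
Let y1_le : y1 * (4 * lam) <= d * y.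
Proof.
rewrite -y1E; have h := z_big3; have : 0 <= y1 by have := y1_ge; lra.
by move=> h2; have := Rmult_le_compat_l _ _ _ h2 h; lra.
Qed.
Let nP : INR nblocks <= y1 < INR nblocks + 1.
Proof. by apply: nfloorP; have := y1_ge; rewrite /y1; lra. Qed.
Let n_ge : 2 < INR nblocks.
Proof. by have := nP; have := y1_ge; lra. Qed.
Let y1_y : y1 <= y.
Proof. 
have h := y1_le; have l := lam_ge; have ds := d_small; have dp := d_pos.
have y0 : 0 < y by have := y_ge; have := z_ge; lra.
have p := y1_ge; nra.
Qed.

Let kap_bound k : (k < nblocks)%N -> 3 <= kap k <= y1 + 2 /\ kap k <= 2 * y.
Proof.
move=> kn; have h1 : INR k + 1 <= INR nblocks by rewrite -S_INR; apply: le_INR; lia.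
have -> : kap k = INR k + 3 by rewrite plus_INR /=; lra.
have := pos_INR k; have := nP; have := y1_y; have := y_ge; have := z_ge; lra.
Qed.

Let base_bound : x * y <= INR base <= 2 * (x * y).
Proof.
rewrite /base S_INR; have h1 : 1 <= x * y by have := x_ge; have := y_ge; have := z_ge; nra.
by have := @nfloorP (x * y) ltac:(lra); lra.
Qed.

Let lnx : ln x = y. Proof. by rewrite xE ln_exp. Qed.
Let lny : ln y = z. Proof. by rewrite yE ln_exp. Qed.
Let ln2 : ln 2 <= 1.
Proof. by have := @ln_le_pred 2 ltac:(lra); lra. Qed.

Local Notation tp := (top A base 3).

Let top_ln k : ln (INR (tp k)) = (kap k + 1) * lam + ln (INR base).
Proof.
have A0 : 0 < INR A by apply: lt_0_INR; have := A_gt0; lia.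
rewrite /top mult_INR INR_expn ln_mult; [|exact: pow_lt|exact: INR_S_gt0].
by rewrite ln_pow // S_INR.
Qed.

Let top_ln_le k : (k < nblocks)%N -> ln (INR (tp k)) <= (1 + d) * y.
Proof.
move=> kn; rewrite top_ln; have [[_ h1] _] := kap_bound kn.
have [b1 b2] := base_bound; have xp := x_ge; have yp := y_ge; have zp := z_ge.
have : ln (INR base) <= ln 2 + (y + z).
  rewrite -lnx -lny -!ln_mult; try nra.
  by apply: ln_le; [exact: INR_S_gt0|rewrite /base -/base; lra].
have : (kap k + 1) * lam <= (y1 + 3) * lam by apply: Rmult_le_compat_r; have := lam_ge; lra.
have := y1_le; have := y_big1; have := y_big2; have := ln2; lra.
Qed.

Let J_bound k : (k < nblocks)%N -> (1 - d) * (c1 * x / (kap k ^ 2 * z)) <= INR (topcount k) <= c1 * x / (kap k ^ 2 * z)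
   /\ 1 <= INR (topcount k).
Proof.
move=> kn; have [[k3 _] k2y] := kap_bound kn.
have zp := z_ge; have yp := y_ge; have c0 := c1_pos; have xp := x_ge.
set v := c1 * x / _.
have den : 0 < kap k ^ 2 * z by apply: Rmult_lt_0_compat; [apply: pow_lt|]; lra.
have v1 : 1 <= d * v.
  apply: (Rmult_le_reg_r (kap k ^ 2 * z)) => //.
  have -> : d * v * (kap k ^ 2 * z) = c1 * d * x by rewrite /v; field; nra.
  apply: Rle_trans x_big1; rewrite Rmult_1_l.
  have -> : 4 * y ^ 3 = (2 * y) ^ 2 * y by ring.
  by apply: Rmult_le_compat; try lra; [apply: pow_le; lra|apply: pow_incr; lra].
have v0 : 0 <= v by apply: Rdiv_le_0_compat => //; nra.
have := nfloorP v0; rewrite -/(topcount k) => h.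
have v8 : 8 <= v by have := d_small; have := d_pos; nra.
by split; [split|]; lra.
Qed.

Let J_le_x k : (k < nblocks)%N -> INR (topcount k) <= x.
Proof.
move=> kn; have [[_ h] _] := J_bound kn; apply: (Rle_trans _ _ _ h).
have [[k3 _] _] := kap_bound kn; have c0 := c1_pos; have xp := x_ge.
have yp := y_ge; have zp := z_ge; have lp := lam_ge.
have x0 : 0 <= x by lra.
apply: (Rle_trans _ (c1 * x)).
  by apply: div_le_self; [apply: Rmult_le_pos; lra|exact: sqr_mul_ge1].
rewrite -[X in _ <= X]Rmult_1_l; apply: Rmult_le_compat_r; first exact: x0.
by rewrite -Rinv_1; apply: Rinv_le_contravar; lra.
Qed.

Let smass_pos : 0 < smass.
Proof.
have lp := lam_ge; have yp := y_ge; have zp := z_ge; have ds := d_small.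
by apply: Rdiv_lt_0_compat; [apply: Rmult_lt_0_compat|]; lra.
Qed.

Let gain_pos : 0 <= gain.
Proof. by apply: Rmult_le_pos; [have := d_small; lra|exact: sqrt_pos]. Qed.

Let i_bound k : (k < nblocks)%N -> INR (divcount k) <= gain / kap k < INR (divcount k) + 1.
Proof.
move=> kn; apply: nfloorP; apply: Rdiv_le_0_compat; first exact: gain_pos.
by have [[h _] _] := kap_bound kn; lra.
Qed.

Let gain_le : gain <= / 2 * sqrt x.
Proof.
have zp := z_ge; have yp := y_ge; have xp := x_ge.
rewrite /gain; apply: Rmult_le_compat; [have := d_small; lra|exact: sqrt_pos|have := d_pos; lra|].
apply: sqrt_le_1_alt; apply: div_le_self; first by lra.
by rewrite -[1]Rmult_1_l; apply: Rmult_le_compat; lra.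
Qed.

(** n uses up only a small proportion of the primes of m. *)
Let i_small k : (k < nblocks)%N -> INR (divcount k) <= d * INR (topcount k).
Proof.
move=> kn; have [h1 _] := i_bound kn; have [[h2 _] _] := J_bound kn.
have [[k3 _] k2y] := kap_bound kn.
have zp := z_ge; have yp := y_ge; have c0 := c1_pos; have xp := x_ge.
have ds := d_small; have dp := d_pos.
apply: (Rle_trans _ _ _ h1); apply: (Rle_trans _ (d * ((1 - d) * (c1 * x / (kap k ^ 2 * z))))); last first.
  by apply: Rmult_le_compat_l; lra.
have den : 0 < kap k ^ 2 * z by apply: Rmult_lt_0_compat; [apply: pow_lt|]; lra.
apply: (Rmult_le_reg_r (kap k ^ 2 * z)) => //.
have -> : gain / kap k * (kap k ^ 2 * z) = kap k * gain * z by field; lra.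
have -> : d * ((1 - d) * (c1 * x / (kap k ^ 2 * z))) * (kap k ^ 2 * z) = d * (1 - d) * (c1 * x).
  by field; lra.
have sx : y ^ 2 <= d / 2 * c1 * sqrt x.
  apply: sqr_le_le; first by apply: Rmult_le_pos; [nra|exact: sqrt_pos].
  rewrite Rpow_mult_distr pow2_sqrt; last by lra.
  by apply: Rle_trans x_big2; apply: Req_le; ring.
have sx0 : 0 < sqrt x by apply: sqrt_lt_R0; lra.
have kg : kap k * gain <= y * sqrt x.
  have -> : y * sqrt x = (2 * y) * (/ 2 * sqrt x) by field.
  by apply: Rmult_le_compat; [lra|exact: gain_pos|exact: k2y|exact: gain_le].
have kg0 : 0 <= kap k * gain by apply: Rmult_le_pos; [lra|exact: gain_pos].
apply: (Rle_trans _ (y * sqrt x * y)); first by apply: Rmult_le_compat; lra.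
have -> : y * sqrt x * y = y ^ 2 * sqrt x by ring.
apply: (Rle_trans _ (d / 2 * c1 * sqrt x * sqrt x)); first by apply: Rmult_le_compat_r; lra.
have -> : d / 2 * c1 * sqrt x * sqrt x = d * (/ 2) * (c1 * x).
  by rewrite Rmult_assoc sqrt_sqrt; [field|]; lra.
apply: Rmult_le_compat_r; first by nra.
by apply: Rmult_le_compat_l; lra.
Qed.

Let divcount_le k : (k < nblocks)%N -> (divcount k <= topcount k)%N.
Proof.
move=> kn; apply/leP; apply: INR_le; apply: (Rle_trans _ _ _ (i_small kn)).
rewrite -[X in _ <= X]Rmult_1_l; apply: Rmult_le_compat_r; first exact: pos_INR.
by have := d_small; lra.
Qed.

Let i_balance k : (k < nblocks)%N ->
  INR (divcount k) <= INR (topcount k - divcount k) * sqrt (smass / INR (topcount k)).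
Proof.
move=> kn; have [h1 _] := i_bound kn; have [[h2 _] J1] := J_bound kn.
have [[k3 _] k2y] := kap_bound kn; have si := i_small kn.
have zp := z_ge; have yp := y_ge; have c0 := c1_pos; have xp := x_ge; have lp := lam_ge.
have ds := d_small; have dp := d_pos.
have iJ := divcount_le kn.
rewrite minus_INR; last exact/leP.
set j := INR (topcount k) in J1 h2 si *; set i := INR (divcount k) in h1 si *.
have s0 := smass_pos.
apply: (Rle_trans _ ((1 - d) * j * sqrt (smass / j))); last first.
  by apply: Rmult_le_compat_r; [exact: sqrt_pos|lra].
have -> : (1 - d) * j * sqrt (smass / j) = (1 - d) * sqrt (smass * j).
  have -> : smass * j = (smass / j) * j ^ 2 by field; lra.
  by rewrite sqrt_mult_alt ?sqrt_pow2; [ring|lra|apply: Rdiv_le_0_compat; lra].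
apply: (Rle_trans _ _ _ h1).
have key : (1 - 3 * d) / 2 * sqrt (x / (y * z)) / kap k <= sqrt (smass * j).
  have yz : 0 < x / (y * z) by apply: Rdiv_lt_0_compat; [|apply: Rmult_lt_0_compat]; lra.
  apply: sqr_le_le; first exact: sqrt_pos.
  rewrite pow2_sqrt; last by apply: Rmult_le_pos; lra.
  rewrite /Rdiv !Rpow_mult_distr pow2_sqrt; last by apply: Rlt_le.
  apply: (Rle_trans _ (smass * ((1 - d) * (c1 * x / (kap k ^ 2 * z))))); last first.
    by apply: Rmult_le_compat_l; lra.
  have -> : smass * ((1 - d) * (c1 * x / (kap k ^ 2 * z))) =
     (1 - 3 * d) * (1 - d) * ((/ 2) ^ 2 * (x * / (y * z)) * (/ kap k) ^ 2).
    by rewrite /smass; field; lra.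
  have -> : (1 - 3 * d) ^ 2 * (/ 2) ^ 2 * (x * / (y * z)) * (/ kap k) ^ 2 =
     (1 - 3 * d) * (1 - 3 * d) * ((/ 2) ^ 2 * (x * / (y * z)) * (/ kap k) ^ 2) by ring.
  apply: Rmult_le_compat_r; last by apply: Rmult_le_compat_l; lra.
  by apply: Rmult_le_pos; [apply: Rmult_le_pos; [lra|apply: Rlt_le]|apply: pow2_ge_0].
apply: (Rle_trans _ ((1 - d) * ((1 - 3 * d) / 2 * sqrt (x / (y * z)) / kap k))); last first.
  by apply: Rmult_le_compat_l; lra.
have -> : (1 - d) * ((1 - 3 * d) / 2 * sqrt (x / (y * z)) / kap k) =
  ((1 - d) * (1 - 3 * d)) * (/ 2 * sqrt (x / (y * z)) * / kap k) by rewrite /Rdiv; ring.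
have -> : gain / kap k = (1 - 4 * d) * (/ 2 * sqrt (x / (y * z)) * / kap k) by rewrite /gain /Rdiv; ring.
apply: Rmult_le_compat_r; last by nra.
apply: Rmult_le_pos; first by have := sqrt_pos (x / (y * z)); lra.
by left; apply: Rinv_0_lt_compat; lra.
Qed.

Let smass_le k : (k < nblocks)%N ->
  smass <= (lam - 21) / ln (INR (tp k)) - INR (topcount k) / INR base.
Proof.
move=> kn; have [[_ h2] J1] := J_bound kn.
have [[k3 _] k2y] := kap_bound kn; have tl := top_ln_le kn.
have zp := z_ge; have yp := y_ge; have c0 := c1_pos; have xp := x_ge; have lp := lam_ge.
have ds := d_small; have dp := d_pos; have [b1 b2] := base_bound; have lb := lam_big.
have b0 : 0 < INR base by exact: INR_S_gt0.
have tl0 : 0 < ln (INR (tp k)).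
  rewrite top_ln; have : 0 <= ln (INR base).
    by rewrite -ln_1; apply: ln_le; [lra|exact: INR_S_ge1].
  have : 0 < (kap k + 1) * lam by rpos.
  lra.
have q1 : (1 - 2 * d) * lam / y <= (lam - 21) / ln (INR (tp k)).
  apply: (Rle_trans _ ((1 - d) * lam / ((1 + d) * y))).
    apply: (Rmult_le_reg_r ((1 + d) * y)); first by rpos.
    have -> : (1 - 2 * d) * lam / y * ((1 + d) * y) = (1 - 2 * d) * (1 + d) * lam by field; lra.
    have -> : (1 - d) * lam / ((1 + d) * y) * ((1 + d) * y) = (1 - d) * lam by field; nra.
    by apply: Rmult_le_compat_r; nra.
  apply: Rmult_le_compat; [apply: Rmult_le_pos; lra| |lra|].
    by left; apply: Rinv_0_lt_compat; apply: Rmult_lt_0_compat; lra.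
  by apply: Rinv_le_contravar.
have q2 : INR (topcount k) / INR base <= d * lam / y.
  apply: (Rmult_le_reg_r (INR base)) => //.
  have -> : INR (topcount k) / INR base * INR base = INR (topcount k) by field; lra.
  apply: (Rle_trans _ (d * lam / y * (x * y))); last first.
    by apply: Rmult_le_compat_l => //; apply: Rdiv_le_0_compat; lra.
  have -> : d * lam / y * (x * y) = d * lam * x by field; lra.
  apply: (Rle_trans _ _ _ (J_le_x kn)).
  by rewrite -{1}[x]Rmult_1_l; apply: Rmult_le_compat_r; lra.
have -> : smass = (1 - 2 * d) * lam / y - d * lam / y by rewrite /smass; field; lra.
lra.
Qed.

(** log (top / J) is kap log A + O(z): here Y, J and 1/c1 only matter through
    O(log y) = O(z), because kap k <= 2 y. *)
Let count_le k : (k < nblocks)%N ->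
  INR (topcount k) * (1 + ln (INR (tp k) / INR (topcount k))) <=
  c1 * x * (lam / z * / kap k + 5 * / kap k ^ 2).
Proof.
move=> kn; have [[h1 h2] J1] := J_bound kn.
have [[k3 _] k2y] := kap_bound kn.
have zp := z_ge; have yp := y_ge; have c0 := c1_pos; have xp := x_ge; have lp := lam_ge.
have ds := d_small; have dp := d_pos; have [b1 b2] := base_bound.
have b0 : 0 < INR base by exact: INR_S_gt0.
have A0 : 0 < INR A by apply: lt_0_INR; have := A_gt0; lia.
have t0 : 0 < INR (tp k).
  by rewrite /top mult_INR INR_expn; apply: Rmult_lt_0_compat => //; exact: pow_lt.
set j := INR (topcount k) in h1 h2 J1 *.
have lnj : y - ln (4 * lam) - 2 * ln (kap k) - ln z - ln 2 <= ln j.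
  have e : ln (c1 * x / (kap k ^ 2 * z) * / 2) = y - ln (4 * lam) - 2 * ln (kap k) - ln z - ln 2.
    have k2 : 0 < kap k ^ 2 by apply: pow_lt; lra.
    rewrite ln_mult; [|apply: Rdiv_lt_0_compat; nra|lra].
    rewrite ln_div; [|nra|nra].
    rewrite ln_mult; [|lra|lra]. rewrite ln_mult; [|lra|lra].
    rewrite ln_pow; last by lra.
    rewrite !ln_Rinv; [|lra|lra].
    by rewrite lnx /=; lra.
  rewrite -e; apply: ln_le.
    apply: Rmult_lt_0_compat; last by lra.
    by apply: Rdiv_lt_0_compat; [nra|apply: Rmult_lt_0_compat; [apply: pow_lt|]; lra].
  apply: Rle_trans h1; rewrite Rmult_comm; apply: Rmult_le_compat_r; last by lra.
  by apply: Rdiv_le_0_compat; [nra|apply: Rmult_lt_0_compat; [apply: pow_lt|]; lra].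
have lnb : ln (INR base) <= ln 2 + (y + z).
  rewrite -lnx -lny -!ln_mult; try nra.
  by apply: ln_le => //; lra.
have lnk : ln (kap k) <= ln 2 + z.
  by rewrite -lny -ln_mult; [apply: ln_le|..]; lra.
have lnz : ln z <= z by have := @ln_le_pred z ltac:(lra); lra.
have e44 : ln (4 * (4 * lam)) = 2 * ln 2 + ln (4 * lam).
  rewrite ln_mult; [|lra|lra]; congr (_ + _).
  have -> : 4 = 2 ^ 2 by lra.
  by rewrite ln_pow /=; lra.
have big : 1 + ln (INR (tp k) / j) <= kap k * lam + 5 * z.
  rewrite ln_div; [|lra|lra]; rewrite top_ln.
  by have := z_big2; rewrite e44; lra.
apply: (Rle_trans _ (c1 * x / (kap k ^ 2 * z) * (kap k * lam + 5 * z))).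
  apply: (Rle_trans _ (j * (kap k * lam + 5 * z))); first by apply: Rmult_le_compat_l; lra.
  by apply: Rmult_le_compat_r; [rpos|exact: h2].
by apply: Req_le; field; lra.
Qed.

Let sum_kap_upper : \sum_(k < nblocks) / kap k <= (1 - d) * z.
Proof.
apply: (Rle_trans _ _ _ (sum_inv_upper _)).
have n2 := n_ge; have [n1 _] := nP.
have -> : (1 - d) * z = ln y1 by rewrite /y1 ln_exp.
have e : INR (2 + nblocks) = INR nblocks + 2 by rewrite plus_INR /=; lra.
rewrite -ln_div; [|rewrite e; lra|lra]; apply: ln_le.
  by apply: Rdiv_lt_0_compat; [rewrite e; lra|lra].
by rewrite e; lra.
Qed.

Let sum_kap_lower : (1 - d) * z - 2 <= \sum_(k < nblocks) / kap k.
Proof.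
apply: Rle_trans (sum_inv_lower _).
have [_ n1] := nP; have n2 := n_ge.
have -> : (1 - d) * z = ln y1 by rewrite /y1 ln_exp.
have e : INR (3 + nblocks) = INR nblocks + 3 by rewrite plus_INR /=; lra.
have : ln y1 <= ln (INR (3 + nblocks)) by apply: ln_le; [have := y1_ge; lra|rewrite e; lra].
by have := @ln_le_pred 3 ltac:(lra); lra.
Qed.

(** The harmonic sum is at most (1-d) z; the sum of the 5/kap^2 is absorbed by the
    hypothesis 21 <= d log A. *)
Let count_total :
  \sum_(k < nblocks) INR (topcount k) * (1 + ln (INR (tp k) / INR (topcount k))) <=
  (1 - d / 2) * x / 4.
Proof.
apply: (Rle_trans _ (\sum_(k < nblocks) c1 * x * (lam / z * / kap k + 5 * / kap k ^ 2))).
  by apply: sumR_le => k _; apply: count_le.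
rewrite -sumR_distrr sumR_add -!sumR_distrr.
have zp := z_ge; have yp := y_ge; have c0 := c1_pos; have xp := x_ge; have lp := lam_ge.
have h1 := sum_kap_upper; have h2 := sum_inv_sqr nblocks.
apply: (Rle_trans _ (c1 * x * (lam / z * ((1 - d) * z) + 5 * (1 / 2)))).
  apply: Rmult_le_compat_l; first by rpos.
  apply: Rplus_le_compat; last by apply: Rmult_le_compat_l; [lra|exact: h2].
  by apply: Rmult_le_compat_l => //; apply: Rdiv_le_0_compat; lra.
have -> : c1 * x * (lam / z * ((1 - d) * z) + 5 * (1 / 2)) = x * c1 * (lam * (1 - d) + 5 / 2).
  by field; lra.
have -> : (1 - d / 2) * x / 4 = x * c1 * (lam * (1 - d / 2)) by field; lra.
by apply: Rmult_le_compat_l; [rpos|have := lam_big; lra].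
Qed.

Let size_ln : \sum_(k < nblocks) INR (divcount k) * ln (INR (tp k)) <= / 2 * sqrt (x * y * z).
Proof.
have zp := z_ge; have yp := y_ge; have xp := x_ge; have ds := d_small; have dp := d_pos.
apply: (Rle_trans _ (\sum_(k < nblocks) (gain * ((1 + d) * y)) * / kap k)).
  apply: sumR_le => k _; have [h _] := i_bound (ltn_ord k); have t := top_ln_le (ltn_ord k).
  have -> : gain * ((1 + d) * y) * / kap k = gain / kap k * ((1 + d) * y) by rewrite /Rdiv; ring.
  apply: Rmult_le_compat => //; first exact: pos_INR.
  rewrite top_ln; have : 0 <= ln (INR base).
    by rewrite -ln_1; apply: ln_le; [lra|exact: INR_S_ge1].
  have [[k3 _] _] := kap_bound (ltn_ord k); have lp := lam_ge.
  have : 0 <= (kap k + 1) * lam by rpos.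
  lra.
rewrite -sumR_distrr.
have g0 := gain_pos.
apply: (Rle_trans _ (gain * ((1 + d) * y) * ((1 - d) * z))).
  by apply: Rmult_le_compat_l; [rpos|exact: sum_kap_upper].
apply: (Rle_trans _ (gain * (y * z))).
  have -> : gain * ((1 + d) * y) * ((1 - d) * z) = gain * ((1 + d) * (1 - d) * (y * z)) by ring.
  apply: Rmult_le_compat_l; first exact: g0.
  rewrite -[X in _ <= X]Rmult_1_l; apply: Rmult_le_compat_r; first by rpos.
  by have := pow2_ge_0 d; lra.
have -> : sqrt (x * y * z) = sqrt (x / (y * z)) * (y * z).
  have -> : x * y * z = x / (y * z) * (y * z) ^ 2 by field; lra.
  rewrite sqrt_mult_alt; last by rpos.
  by rewrite sqrt_pow2; [|rpos].
rewrite -[X in _ <= X]Rmult_assoc; apply: Rmult_le_compat_r; first by rpos.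
by rewrite /gain; apply: Rmult_le_compat_r; [exact: sqrt_pos|lra].
Qed.

Let W := sqrt (x * z / y).

(** The loss of a factor e^(O(y)) per block is e^(O(y^2)) in all, negligible against
    e^(d W). *)
Let gain_total : (1 / 2 - 4 * d) * W + 10 <=
  \sum_(k < nblocks) (INR (divcount k) - 1 - ln (INR (divcount k).+1)).
Proof.
have zp := z_ge; have yp := y_ge; have xp := x_ge; have ds := d_small; have dp := d_pos.
have g0 := gain_pos.
have gx : gain + 1 <= x.
  have sx : sqrt x ^ 2 = x by rewrite pow2_sqrt; lra.
  have s2 : 2 <= sqrt x by apply: sqr_le_le; [exact: sqrt_pos|rewrite sx; lra].
  have := Rmult_le_compat_r _ _ _ (sqrt_pos x) s2; have := gain_le; lra.
apply: (Rle_trans _ (\sum_(k < nblocks) (gain * / kap k - (2 + y)))); last first.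
  apply: sumR_le => k _; have [h1 h2] := i_bound (ltn_ord k).
  have [[k3 _] _] := kap_bound (ltn_ord k).
  have : ln (INR (divcount k).+1) <= y.
    rewrite -lnx; apply: ln_le; first exact: INR_S_gt0.
    rewrite S_INR; have : gain / kap k <= gain; last by lra.
    by apply: div_le_self; lra.
  by rewrite /Rdiv in h1 h2; lra.
rewrite sumR_sub sumR_const card_ord -sumR_distrr.
have [n1 _] := nP; have yy := y1_y.
have h := Rmult_le_compat_l _ _ _ g0 sum_kap_lower.
have : INR nblocks * (2 + y) <= y * (2 + y) by apply: Rmult_le_compat_r; lra.
have WE : sqrt (x / (y * z)) * z = W.
  rewrite /W; have -> : x * z / y = x / (y * z) * z ^ 2 by field; lra.
  rewrite sqrt_mult_alt; last by rpos.
  by rewrite sqrt_pow2 //; lra.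
have W0 : 0 <= W := sqrt_pos _.
have h2 : (1 / 2 - 3 * d) * W <= gain * ((1 - d) * z - 2).
  apply: (Rle_trans _ (gain * ((1 - 2 * d) * z))); last first.
    by apply: Rmult_le_compat_l => //; have := z_big1; lra.
  have -> : gain * ((1 - 2 * d) * z) = (1 - 4 * d) / 2 * (1 - 2 * d) * W.
    by rewrite -WE /gain; field.
  apply: Rmult_le_compat_r; first exact: W0.
  by have := pow2_ge_0 d; lra.
have h3 : y * (2 + y) + 10 <= d * W.
  apply: (Rle_trans _ (3 * y ^ 2)).
    have y16 : 16 <= y by lra.
    by have := Rmult_le_compat_r y _ _ ltac:(lra) y16; lra.
  apply: sqr_le_le; first by apply: Rmult_le_pos; lra.
  rewrite [X in _ <= X]Rpow_mult_distr /W pow2_sqrt; last by rpos.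
  apply: (Rmult_le_reg_r y); first by lra.
  have -> : d ^ 2 * (x * z / y) * y = d ^ 2 * x * z by field; lra.
  have -> : (3 * y ^ 2) ^ 2 * y = 9 * y ^ 5 by ring.
  apply: (Rle_trans _ _ _ x_big3).
  by rewrite -{1}[d ^ 2 * x]Rmult_1_r; apply: Rmult_le_compat_l; [rpos|lra].
move=> h4; apply: (Rle_trans _ (gain * ((1 - d) * z - 2) - INR nblocks * (2 + y))).
  by lra.
by apply: Rplus_le_compat_r; exact: h.
Qed.

(** For M = O(T^(3/2)) the second term on the right side is at most 1 when L is the
    integer part of T and H is about sqrt T. *)
Theorem resonance_bound (L H m : nat) (mx : R) :
  (0 < L)%N -> 0 <= mx ->
  (forall t : nat, (H <= t < L)%N -> dnorm m.+1 (INR t) <= mx) ->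
  (forall N : nat, ln (INR N) <= / 2 * sqrt (x * y * z) -> (N <= m.+1)%N) ->
  exp ((1 / 2 - 4 * d) * W + 10) / 4 <=
  36 * mx + 2 / INR L * exp ((1 - d / 2) * x / 4) * \sum_(t < H) dnorm m.+1 (INR t).
Proof.
move=> L0 mx0 mxm sz.
have zp := z_ge; have yp := y_ge; have xp := x_ge; have ds := d_small; have dp := d_pos.
have lp := lam_ge; have c0 := c1_pos; have [b1 b2] := base_bound.
have base0 : (0 < base)%N by [].
have topb k : (base <= tp k)%N by rewrite /top leq_pmull // expn_gt0 A_gt0.
have J0 (k : 'I_nblocks) : (0 < topcount k)%N.
  by have [_ h] := J_bound (ltn_ord k); case: (posnP (topcount k)) => // e; move: h; rewrite e /=; lra.
have iJ (k : 'I_nblocks) : (divcount k <= topcount k)%N.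
  exact: divcount_le (ltn_ord k).
have Jt (k : 'I_nblocks) : (topcount k <= tp k)%N.
  apply: leq_trans (topb k); apply/leP; apply: INR_le; apply: Rle_trans b1.
  apply: (Rle_trans _ _ _ (J_le_x (ltn_ord k))).
  by rewrite -{1}[x]Rmult_1_r; apply: Rmult_le_compat_l; lra.
have t1 (k : 'I_nblocks) : (1 < tp k)%N.
  apply: leq_trans (topb k); apply/ltP; apply: INR_lt; rewrite [INR 1]/=.
  by apply: Rlt_le_trans b1; rewrite -[1]Rmult_1_l; apply: Rmult_gt_0_lt_compat; lra.
have s0 (k : 'I_nblocks) := smass_pos.
have szp : (\prod_(k < nblocks) expn (tp k) (divcount k) <= m.+1)%N.
  apply: sz; rewrite INR_prodn ln_prodR => [|k _]; last first.
    by rewrite INR_expn; apply: pow_lt; apply: lt_0_INR; have := t1 k; lia.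
  apply: Rle_trans size_ln; apply: Req_le; apply: eq_bigr => k _.
  by rewrite INR_expn ln_pow //; apply: lt_0_INR; have := t1 k; lia.
have res := @prime_blocks_resonance A base 3 nblocks A_gt0 base0
  (fun k => topcount k) (fun k => divcount k) (fun _ => smass) L H m mx J0 iJ Jt t1 s0
  (fun k => smass_le (ltn_ord k)) (fun k => i_balance (ltn_ord k)) szp L0 mx0 mxm.
apply: (Rle_trans _ _ _ (Rle_trans _ _ _ _ res)).
  by apply: Rmult_le_compat_r; [lra|apply: exp_le_compat; exact: gain_total].
apply: Rplus_le_compat_l; apply: Rmult_le_compat_r.
  by apply: sumR_ge0 => t _; exact: dnorm_ge0.
apply: Rmult_le_compat_l; last by apply: exp_le_compat; exact: count_total.
by apply: Rdiv_le_0_compat; [lra|apply: lt_0_INR; lia].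
Qed.
End Params.


(** * Large values of T *)

Definition for_large (P : R -> Prop) : Prop := exists a : R, forall t : R, a <= t -> P t.

Lemma for_large_and P Q : for_large P -> for_large Q -> for_large (fun t => P t /\ Q t).
Proof.
move=> [a ha] [b hb]; exists (Rmax a b) => t h.
by split; [apply: ha|apply: hb]; have := Rmax_l a b; have := Rmax_r a b; lra.
Qed.

Lemma for_large_impl (P Q : R -> Prop) : (forall t, P t -> Q t) -> for_large P -> for_large Q.
Proof. by move=> PQ [a h]; exists a => t /h /PQ. Qed.

Lemma for_large_ge a : for_large (fun t => a <= t).
Proof. by exists a. Qed.

Lemma for_large_ln P : for_large P -> for_large (fun t => P (ln t)).
Proof.
move=> [a h]; exists (exp a) => t ht; apply: h.
by rewrite -(ln_exp a); apply: ln_le => //; exact: exp_pos.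
Qed.

Lemma for_large_scale d P : 0 < d -> for_large P -> for_large (fun t => P (d * t)).
Proof.
move=> d0 [a h]; exists (a / d) => t ht; apply: h.
have := Rmult_le_compat_l _ _ _ (Rlt_le _ _ d0) ht.
by have -> : d * (a / d) = a by field; lra.
Qed.

Lemma for_large_pow_le_exp C k : for_large (fun t => C * t ^ k <= exp t).
Proof.
have n0 := INR_S_gt0 k; set n := INR k.+1 in n0.
exists (Rmax 1 (Rabs C * n ^ k.+1)) => t ht.
have t1 : 1 <= t by have := Rmax_l 1 (Rabs C * n ^ k.+1); lra.
have tC : Rabs C * n ^ k.+1 <= t by have := Rmax_r 1 (Rabs C * n ^ k.+1); lra.
have nk : 0 < n ^ k.+1 by exact: pow_lt.
apply: (Rle_trans _ ((t / n) ^ k.+1)); last first.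
  have -> : exp t = exp (t / n) ^ k.+1.
    rewrite -Rpower_pow; last exact: exp_pos.
    by rewrite /Rpower ln_exp -/n; congr exp; field; lra.
  apply: pow_incr; split; first by apply: Rdiv_le_0_compat; lra.
  by have := exp_ineq1_le (t / n); lra.
rewrite /Rdiv Rpow_mult_distr pow_inv.
apply: (Rmult_le_reg_r (n ^ k.+1)) => //.
rewrite Rmult_assoc [X in _ <= X]Rmult_assoc Rinv_l ?Rmult_1_r; last by lra.
have tk : 0 <= t ^ k by apply: pow_le; lra.
have -> : t ^ k.+1 = t * t ^ k by [].
have -> : C * (t ^ k * n ^ k.+1) = (C * n ^ k.+1) * t ^ k by ring.
apply: Rmult_le_compat_r => //.
have := Rmult_le_compat_r _ _ _ (Rlt_le _ _ nk) (Rle_abs C); lra.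
Qed.

Lemma dnorm_continuous m t : continuity_pt (dnorm m) t.
Proof.
have sums (F : 'I_m -> R -> R) s : (forall i, continuous (F i) s) ->
    continuous (fun u => \sum_(i < m) F i u) s.
  move=> Fc; elim: (index_enum 'I_m) => [|i l IH].
    by apply: (continuous_ext (fun _ => 0)) => [u|]; [rewrite big_nil|exact: continuous_const].
  apply: (continuous_ext (fun u => F i u + \sum_(j <- l) F j u)) => [u|].
    by rewrite big_cons.
  exact: (continuous_plus (F i)).
apply/continuity_pt_filterlim.
rewrite /dnorm /tnorm /csum /ssum.
apply: (continuous_comp (fun u => csum (@dweight m) (fun i => u * dfreq i) ^ 2 +
  ssum (@dweight m) (fun i => u * dfreq i) ^ 2) sqrt); last exact: continuous_sqrt.
have sq f s : continuous f s -> continuous (fun u => f u ^ 2) s.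
  move=> fc; apply: (continuous_ext (fun u => f u * f u)) => [u|]; first by rewrite /=; ring.
  exact: (continuous_mult f f).
apply: (continuous_plus (fun u => _ ^ 2)); apply: sq; apply: sums => i.
  by apply: ex_derive_continuous; auto_derive.
by apply: ex_derive_continuous; auto_derive.
Qed.

(** The conditions on z, y and x are separated, each one being a property of all
    sufficiently large values of one iterated logarithm. *)
Lemma for_large_z d lam : 0 < d ->
  for_large (fun z => 2 <= d * z /\ lam + ln (4 * (4 * lam)) + 2 * ln 2 + 2 <= z /\
    4 * lam <= d * exp (d * z) /\ 2 * (z + 1) <= d * exp z).
Proof.
move=> d0; have [a1 h1] := for_large_scale d0 (for_large_ge (Rmax 2 (4 * lam / d))).
have [a2 h2] := for_large_pow_le_exp (4 / d) 1.
exists (Rmax (Rmax a1 a2) (Rmax 1 (lam + ln (4 * (4 * lam)) + 2 * ln 2 + 2))) => z hz.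
have m1 := Rmax_l (Rmax a1 a2) (Rmax 1 (lam + ln (4 * (4 * lam)) + 2 * ln 2 + 2)).
have m2 := Rmax_r (Rmax a1 a2) (Rmax 1 (lam + ln (4 * (4 * lam)) + 2 * ln 2 + 2)).
have m3 := Rmax_l a1 a2; have m4 := Rmax_r a1 a2.
have m5 := Rmax_l 1 (lam + ln (4 * (4 * lam)) + 2 * ln 2 + 2).
have m6 := Rmax_r 1 (lam + ln (4 * (4 * lam)) + 2 * ln 2 + 2).
have {}h1 := h1 z ltac:(lra); have {}h2 := h2 z ltac:(lra).
have m7 := Rmax_l 2 (4 * lam / d); have m8 := Rmax_r 2 (4 * lam / d).
split; [lra|split; [lra|split]].
  have e : 4 * lam = d * (4 * lam / d) by field; lra.
  by rewrite {1}e; apply: Rmult_le_compat_l; [|have := exp_ineq1_le (d * z)]; lra.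
have := Rmult_le_compat_l _ _ _ (Rlt_le _ _ d0) h2.
have -> : d * (4 / d * z ^ 1) = 4 * z by field; lra.
lra.
Qed.

Lemma for_large_y d lam : 0 < d -> 0 < lam ->
  for_large (fun y => (1 <= y /\ 16 * lam <= d * y) /\ 4 * y ^ 3 <= / (4 * lam) * d * exp y /\
    y ^ 4 <= (d / 2 * / (4 * lam)) ^ 2 * exp y /\ 9 * y ^ 5 <= d ^ 2 * exp y).
Proof.
move=> d0 l0.
have big b k a : 0 < b -> for_large (fun y => a * y ^ k <= b * exp y).
  move=> b0; have := for_large_pow_le_exp (a / b) k; apply: for_large_impl => y h.
  have := Rmult_le_compat_l _ _ _ (Rlt_le _ _ b0) h.
  by have -> : b * (a / b * y ^ k) = a * y ^ k by field; lra.
have il : 0 < / (4 * lam) by apply: Rinv_0_lt_compat; lra.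
apply: for_large_and; first exact: for_large_and (for_large_ge 1) (for_large_scale d0 (for_large_ge (16 * lam))).
apply: for_large_and; first by apply: big; rpos.
apply: for_large_and; last by apply: big; rpos.
have := big ((d / 2 * / (4 * lam)) ^ 2) 4%N 1 ltac:(rpos); apply: for_large_impl => y.
by rewrite Rmult_1_l.
Qed.

Lemma for_large_x d : 0 < d -> for_large (fun x => 4 <= x /\ 800 * x <= exp (d * x / 8)).
Proof.
move=> d0; apply: for_large_and; first exact: for_large_ge.
have := for_large_scale (ltac:(lra) : 0 < d / 8) (for_large_pow_le_exp (800 * 8 / d) 1).
apply: for_large_impl => x; have -> : 800 * 8 / d * (d / 8 * x) ^ 1 = 800 * x by field; lra.
by have -> : d / 8 * x = d * x / 8 by field.
Qed.

(** Here the main term M^(1/2+it) / (1/2+it) has size at least 50 T^(1/4), against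
    an error of at most 36 T^(1/4). *)
Lemma long_sum_large (T : R) (m : nat) (W : R) : 1 <= T ->
  10000 * (T * sqrt T) <= INR m.+1 -> W <= ln T / 4 ->
  exp W <= dnorm m (sqrt T).
Proof.
move=> T1 hm hW; set t := sqrt T in hm *.
have t1 : 1 <= t by rewrite -sqrt_1; apply: sqrt_le_1_alt.
have T0 : t * t = T by apply: sqrt_sqrt; lra.
have s1 : 1 <= sqrt t by rewrite -sqrt_1; apply: sqrt_le_1_alt.
have ss : sqrt t * sqrt t = t by apply: sqrt_sqrt; lra.
have tm : t <= INR m by rewrite S_INR in hm; nra.
apply: Rle_trans (dnorm_lower t1 tm).
have r : 100 * (t * sqrt t) <= sqrt (INR m.+1).
  apply: sqr_le_le; first exact: sqrt_pos.
  rewrite pow2_sqrt; last exact: pos_INR.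
  have -> : (100 * (t * sqrt t)) ^ 2 = 10000 * (t * t * (sqrt t * sqrt t)) by ring.
  by rewrite ss T0.
have : exp W <= sqrt t.
  have -> : sqrt t = exp (ln T / 4).
    rewrite -(Rpower_sqrt t); last by lra.
    rewrite /Rpower -T0 ln_mult; [|lra|lra]; congr exp; field.
  exact: exp_le_compat.
have : 50 * sqrt t <= sqrt (INR m.+1) / (2 * t).
  apply: (Rmult_le_reg_r (2 * t)); first by lra.
  have -> : sqrt (INR m.+1) / (2 * t) * (2 * t) = sqrt (INR m.+1) by field; lra.
  by apply: Rle_trans r; apply: Req_le; ring.
lra.
Qed.



(** The exponents of T add up to 1/4 - d/8 + 3/4 - 1 = -d/8. *)
Lemma short_range_small (T d : R) (h m : nat) : 0 < d -> 2 <= T -> 4 <= ln T ->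
  800 * ln T <= exp (d * ln T / 8) ->
  INR m.+1 <= 10201 * (T * sqrt T) -> INR h.+1 <= sqrt T ->
  2 / INR (nfloor T) * exp ((1 - d / 2) * ln T / 4) * \sum_(t < h.+2) dnorm m (INR t) <= 1.
Proof.
move=> d0 T2 x4 hx hm hh; set x := ln T in x4 hx *.
set r := exp (x / 4); have r0 : 0 < r := exp_pos _.
have rp k : r ^ k = exp (INR k * (x / 4)) by rewrite -Rpower_pow // /Rpower /r ln_exp.
have rT : T = r ^ 4 by rewrite rp -(exp_ln T); [congr exp; rewrite /x /=; field|lra].
have r1 : 1 <= r by rewrite -exp_0; apply: exp_le_compat; lra.
have sT : sqrt T = r ^ 2.
  have -> : T = (r ^ 2) ^ 2 by rewrite rT; ring.
  by rewrite sqrt_pow2 //; apply: pow_le; lra.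
have sm : sqrt (INR m.+1) <= 101 * r ^ 3.
  apply: sqr_le_le; first by rpos.
  rewrite pow2_sqrt; last exact: pos_INR.
  by apply: (Rle_trans _ _ _ hm); apply: Req_le; rewrite sT rT; ring.
have sq : sqrt (INR h.+1) <= r.
  apply: sqr_le_le; first by lra.
  by rewrite pow2_sqrt; [rewrite -sT|exact: pos_INR].
have lq : ln (INR h.+1) <= x.
  apply: ln_le; first exact: INR_S_gt0.
  by apply: (Rle_trans _ _ _ hh); rewrite sT rT; apply: Rle_pow => //; lia.
have S : \sum_(t < h.+2) dnorm m (INR t) <= 200 * x * r ^ 3.
  apply: (Rle_trans _ _ _ (sum_dnorm_le m h)).
  apply: (Rle_trans _ (101 * r ^ 3 * (3 + x) + 36 * (r ^ 2 * r))).
    apply: Rplus_le_compat.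
      apply: Rmult_le_compat => //; [exact: sqrt_pos| |lra].
      have : 0 <= ln (INR h.+1) by rewrite -ln_1; apply: ln_le; [lra|exact: INR_S_ge1].
      lra.
    apply: Rmult_le_compat_l; first by lra.
    by apply: Rmult_le_compat => //; [exact: pos_INR|exact: sqrt_pos|rewrite -sT].
  have -> : 101 * r ^ 3 * (3 + x) + 36 * (r ^ 2 * r) = (339 + 101 * x) * r ^ 3 by ring.
  by apply: Rmult_le_compat_r; [rpos|lra].
have Lb : r ^ 4 / 2 <= INR (nfloor T).
  by rewrite -rT; have := @nfloorP T ltac:(lra); lra.
have r4 : 0 < r ^ 4 by rpos.
have L0 : 2 / INR (nfloor T) <= 4 / r ^ 4.
  have -> : 4 / r ^ 4 = 2 * / (r ^ 4 / 2) by field; lra.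
  by apply: Rmult_le_compat_l; [lra|apply: Rinv_le_contravar; lra].
have e : exp ((1 - d / 2) * x / 4) = r * / exp (d * x / 8).
  by rewrite -exp_Ropp -exp_plus; congr exp; field.
set E := exp (d * x / 8) in hx e.
have E0 : 0 < E := exp_pos _.
apply: (Rle_trans _ (4 / r ^ 4 * (r * / E) * (200 * x * r ^ 3))).
  apply: Rmult_le_compat => //.
  - apply: Rmult_le_pos; [apply: Rdiv_le_0_compat; lra|exact: Rlt_le (exp_pos _)].
  - by apply: sumR_ge0 => t _; exact: dnorm_ge0.
  - rewrite e; apply: Rmult_le_compat_r => //; rpos.
apply: (Rmult_le_reg_r E) => //.
have -> : 4 / r ^ 4 * (r * / E) * (200 * x * r ^ 3) * E = 800 * x by field; lra.
lra.
Qed.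

(** * The lower bound *)

Theorem theorem2 :
  forall c : R, 0 < c < 1 / 2 ->
  exists T0 : R, forall T : R, T0 <= T ->
  forall M : R, 1 <= M ->
    exp (exp 1 * sqrt (1 / 2 * ln T * ln (ln T) * ln (ln (ln T)))) <= M ->
    exists m : R,
      is_max_on (fun t : R => Cmod (zeta_sum M t)) (sqrt T) T m /\
      exp (c * sqrt (ln T * ln (ln (ln T)) / ln (ln T))) <= m.
Proof.
move=> c hc; set d := (1 / 2 - c) / 4.
have d0 : 0 < d by rewrite /d; lra.
have d8 : d <= 1 / 8 by rewrite /d; lra.
have cE : c = 1 / 2 - 4 * d by rewrite /d; field.
set A := (nfloor (exp (21 / d))).+1.
have A_gt0 : (0 < A)%N by [].
have lamb : 21 <= d * ln (INR A).
  have -> : 21 = d * (21 / d) by field; lra.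
  apply: Rmult_le_compat_l; first by lra.
  rewrite -[21 / d]ln_exp; apply: ln_le; first exact: exp_pos.
  by rewrite /A S_INR; have := @nfloorP (exp (21 / d)) (Rlt_le _ _ (exp_pos _)); lra.
have l0 : 0 < ln (INR A) by nra.
have [az hz] := for_large_ln (for_large_ln (for_large_ln (for_large_z (ln (INR A)) d0))).
have [ay hy] := for_large_ln (for_large_ln (for_large_y d0 l0)).
have [ax hx] := for_large_ln (for_large_x d0).
exists (Rmax 2 (Rmax az (Rmax ay ax))) => T hT M M1 hM.
have [T2 [Taz [Tay Tax]]] : 2 <= T /\ az <= T /\ ay <= T /\ ax <= T.
  have := Rmax_l 2 (Rmax az (Rmax ay ax)); have := Rmax_r 2 (Rmax az (Rmax ay ax)).
  have := Rmax_l az (Rmax ay ax); have := Rmax_r az (Rmax ay ax).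
  by have := Rmax_l ay ax; have := Rmax_r ay ax; repeat split; lra.
have {hz} [z1 [z2 [z3 z4]]] := hz T Taz.
have {hy} [[y0 y1] [y2 [y3 y4]]] := hy T Tay.
have {hx} [x4 x5] := hx T Tax.
set x := ln T in z1 z2 z3 z4 y0 y1 y2 y3 y4 x4 x5 hM *.
set y := ln x in z1 z2 z3 z4 y0 y1 y2 y3 y4 hM *.
set z := ln y in z1 z2 z3 z4 hM *.
have xE : x = exp y by rewrite exp_ln //; lra.
have yE : y = exp z by rewrite exp_ln //; lra.
rewrite -yE in z4; rewrite -xE in y2 y3 y4.
have z_pos : 16 <= z by nra.
have yz : z + 1 <= y by rewrite yE; have := exp_ineq1_le z; lra.
have xy : y + 1 <= x by rewrite xE; have := exp_ineq1_le y; lra.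
set W := sqrt (x * z / y).
have Tsq : 1 <= sqrt T <= T.
  have s1 : 1 <= sqrt T by rewrite -sqrt_1; apply: sqrt_le_1_alt; lra.
  by split=> //; have := sqrt_sqrt T; nra.
set m := nfloor M; have mP := @nfloorP M ltac:(lra); rewrite -/m in mP.
have valE t : Cmod (zeta_sum M t) = dnorm m t by exact: zeta_sum_norm.
have [tm [tmax tin]] := continuity_ab_maj (dnorm m) (sqrt T) T (proj2 Tsq) (fun t _ => dnorm_continuous m t).
exists (dnorm m tm); split.
  split; first by exists tm; split; [exact: tin|exact: valE].
  by move=> t ht; rewrite valE; exact: tmax.
have W0 : 0 <= W := sqrt_pos _.
case: (Rle_dec (10000 * (T * sqrt T)) (INR m.+1)) => big.
  apply: (Rle_trans _ (dnorm m (sqrt T))); last by apply: tmax; lra.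
  apply: long_sum_large => //; first by lra.
  rewrite -/x; have : W <= x / 2; last by nra.
  apply: sqr_le_le; first by lra.
  rewrite pow2_sqrt; last by apply: Rdiv_le_0_compat; nra.
  apply: (Rmult_le_reg_r y); first by lra.
  have -> : x * z / y * y = x * z by field; lra.
  have -> : (x / 2) ^ 2 * y = x * (x * y / 4) by field.
  by apply: Rmult_le_compat_l; nra.
have m1 : (0 < m)%N by apply/ltP; apply: INR_lt; rewrite [INR 0]/=; lra.
case mE : m m1 => [//|m'] _.
set q := nfloor (sqrt T); have qP := @nfloorP (sqrt T) ltac:(lra); rewrite -/q in qP.
have q1 : (0 < q)%N by apply/ltP; apply: INR_lt; rewrite [INR 0]/=; lra.
case qE : q q1 => [//|h] _.
have LP := @nfloorP T ltac:(lra).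
have L0 : (0 < nfloor T)%N by apply/ltP; apply: INR_lt; rewrite [INR 0]/=; lra.
set mx := dnorm m'.+1 tm.
have mx0 : 0 <= mx := dnorm_ge0 _ _.
have mxm (t : nat) : (h.+2 <= t < nfloor T)%N -> dnorm m'.+1 (INR t) <= mx.
  move=> /andP[t1 t2]; rewrite /mx -mE; apply: tmax.
  have : INR h.+2 <= INR t by apply: le_INR; lia.
  have : INR t <= INR (nfloor T) by apply: le_INR; lia.
  by rewrite S_INR -qE; lra.
have sz (N : nat) : ln (INR N) <= / 2 * sqrt (x * y * z) -> (N <= m'.+1)%N.
  case: N => // N hN; rewrite -ltnS -mE; apply/ltP; apply: INR_lt; rewrite (S_INR m).
  apply: Rle_lt_trans (proj2 mP); apply: Rle_trans hM.
  rewrite -(exp_ln (INR N.+1)); last exact: INR_S_gt0.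
  apply: exp_le_compat; apply: (Rle_trans _ _ _ hN).
  have -> : 1 / 2 * x * y * z = 1 / 2 * (x * y * z) by ring.
  have p : 0 <= x * y * z by rpos.
  have s4 : / 2 * sqrt (x * y * z) <= sqrt (1 / 2 * (x * y * z)).
    apply: sqr_le_le; first exact: sqrt_pos.
    by rewrite Rpow_mult_distr !pow2_sqrt; lra.
  have e1 := exp_ineq1_le 1; have := sqrt_pos (1 / 2 * (x * y * z)); nra.
have bound := resonance_bound A_gt0 d0 d8 lamb xE yE z1 z2 z3 y1 z4 y2 y3 y4 L0 mx0 mxm sz.
have small : 2 / INR (nfloor T) * exp ((1 - d / 2) * x / 4) *
   \sum_(t < h.+2) dnorm m'.+1 (INR t) <= 1.
  apply: short_range_small => //.
    have : 1 <= T * sqrt T by nra.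
    by move: big; rewrite !S_INR mE S_INR; lra.
  by rewrite -qE; lra.
have {small} bound := Rle_trans _ _ _ bound (Rplus_le_compat_l _ _ _ small).
rewrite -/W -cE exp_plus in bound.
have e10 : 1024 <= exp 10.
  have -> : exp 10 = exp 1 ^ 10 by rewrite -Rpower_pow; [rewrite /Rpower ln_exp /=; congr exp; ring|exact: exp_pos].
  have -> : 1024 = 2 ^ 10 by ring.
  by apply: pow_incr; have := exp_ineq1_le 1; lra.
have eW : 1 <= exp (c * W) by rewrite -exp_0; apply: exp_le_compat; nra.
have := Rmult_le_compat_l _ _ _ (Rlt_le _ _ (exp_pos (c * W))) e10.
lra.
Qed.
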